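(* Let $M\ge1$ and $N\ge2$ be integers and let $\mathbb P^1_N$ be the complex measure of total mass one (case $\theta=1$) described in the context, with non-vanishing weights $w,\tau$. Let $\mathcal M\subseteq\mathbb C$ be open with $[0,M+N]\subset\mathcal M$. Suppose there exist six functions $\phi^t_i,\phi^b_i,\phi^m_i$, $i=1,2$, analytic in $\mathcal M$, such that $$\frac{\phi_1^t(z)}{\phi_1^m(z)}=\frac{w(z-1)}{w(z)},\quad \frac{\phi_1^b(\hat z)}{\phi_1^m(\hat z)}=\frac{\tau(\hat z)}{\tau(\hat z-1)},\quad \frac{\phi_2^t(z)}{\phi_2^m(z)}=\frac{w(z)}{w(z-1)},\quad \frac{\phi_2^b(\hat z-1)}{\phi_2^m(\hat z-1)}=\frac{\tau(\hat z-1)}{\tau(\hat z)}$$ for all $z\in[1,M+N-1]$ and $\hat z\in[2,M+N-1]$. Put $s_N=M+N$ and define $$R_1(z)=\phi_1^t(z)\,\mathbb E\Big[\prod_{i=1}^N\frac{z-\ell_i-1}{z-\ell_i}\Big]+\phi_1^b(z)\,\mathbb E\Big[\prod_{i=1}^{N-1}\frac{z-m_i}{z-m_i-1}\Big]+\phi_1^m(z)\,\mathbb E\Big[\sum_{i=1}^N\frac1{z-\ell_i-1}-\sum_{i=1}^{N-1}\frac1{z-m_i}\Big]-\frac{r_1^-(N)}z-\frac{r_1^+(N)}{z-s_N},$$ $$R_2(z)=\phi_2^t(z)\,\mathbb E\Big[\prod_{i=1}^N\frac{z-\ell_i}{z-\ell_i-1}\Big]+\phi_2^b(z)\,\mathbb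 E\Big[\prod_{i=1}^{N-1}\frac{z-m_i}{z-m_i+1}\Big]+\phi_2^m(z)\,\mathbb E\Big[\sum_{i=1}^{N-1}\frac1{z-m_i}-\sum_{i=1}^N\frac1{z-\ell_i}\Big]-\frac{r_2^-(N)}z-\frac{r_2^+(N)}{z-s_N},$$ where $$r_1^-(N)=-\phi_1^t(0)\,\mathbb P^1_N(\ell_N=0)\,\mathbb E\Big[\prod_{i=1}^{N-1}\frac{\ell_i+1}{\ell_i}\,\Big|\,\ell_N=0\Big],$$ $$r_1^+(N)=\phi_1^b(s_N)\,\mathbb P^1_N(m_1=s_N-1)\,\mathbb E\Big[\prod_{i=2}^{N-1}\frac{s_N-m_i}{s_N-m_i-1}\,\Big|\,m_1=s_N-1\Big]+\phi_1^m(s_N)\,\mathbb P^1_N(\ell_1=s_N-1),$$ $$r_2^-(N)=-\phi_2^b(0)\,\mathbb P^1_N(m_{N-1}=1)\,\mathbb E\Big[\prod_{i=1}^{N-2}\frac{m_i}{m_i-1}\,\Big|\,m_{N-1}=1\Big]-\phi_2^m(0)\,\mathbb P^1_N(\ell_N=0),$$ $$r_2^+(N)=\phi_2^t(s_N)\,\mathbb P^1_N(\ell_1=s_N-1)\,\mathbb E\Big[\prod_{i=2}^N\frac{s_N-\ell_i}{s_N-\ell_i-1}\,\Big|\,\ell_1=s_N-1\Big].$$ Then $R_1(z)$ and $R_2(z)$ are analytic in $\mathcal M$ (i.e. all their apparent poles are removable).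
   Context: **The measure.** For integers $N\ge2$, $M\ge1$ let $\mathfrak X^1_N$ be the finite set of pairs $(\ell,m)$, $\ell=(\ell_1,\dots,\ell_N)$, $m=(m_1,\dots,m_{N-1})$, with $\ell_i=\lambda_i+N-i$, $m_i=\mu_i+N-i$, where $\lambda_i,\mu_i\in\mathbb Z$ and $M\ge\lambda_1\ge\mu_1\ge\lambda_2\ge\cdots\ge\mu_{N-1}\ge\lambda_N\ge0$. Let $w(x)=w(x;N)$ be a complex-valued function, non-zero for $x\in[0,M+N-1]$, and $\tau(x)=\tau(x;N)$ a complex-valued function, non-zero for $x\in[1,M+N-1]$. The complex measure is $$\mathbb P^1_N(\ell,m)=Z_N^{-1}\prod_{1\le i<j\le N}(\ell_i-\ell_j)\prod_{i=1}^Nw(\ell_i)\prod_{1\le i<j\le N-1}(m_i-m_j)\prod_{i=1}^{N-1}\tau(m_i),$$ where the normalization constant $Z_N$ (the sum of the remaining expression over $\mathfrak X^1_N$) is assumed non-zero, so the total mass is one. (This is the $\theta=1$ case of the general two-level measure, whose interaction factor $I(\ell,m)$ equals $1$ when $\theta=1$.) $\mathbb E[F]=\sum_{(\ell,m)}F(\ell,m)\mathbb P^1_N(\ell,m)$, and a product $\mathbb P^1_N(A)\,\mathbb E[F\mid A]$ means $\mathbb E[F\,\mathbf 1_A]$. Empty products equal $1$. *)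

(* Defs.v *)
From mathcomp Require Import all_boot all_order all_algebra.
From mathcomp Require Import all_classical all_reals all_analysis.
From mathcomp Require Import complex.

Set Implicit Arguments.
Unset Strict Implicit.
Unset Printing Implicit Defensive.

Import Order.TTheory GRing.Theory Num.Theory.
Import numFieldNormedType.Exports.

Local Open Scope classical_set_scope.
Local Open Scope ring_scope.
Local Open Scope complex_scope.

(* [R[i]] carries its metric topology through the alias [(R[i])^o]. *)
Definition analytic_on (R : realType) (D : set (R[i])^o) (f : R[i] -> R[i]) :=
  forall a : (R[i])^o, D a ->
    exists c : nat -> R[i],
      \forall z \near a,
        series (fun k => c k * (z - a) ^+ k : (R[i])^o) @ \oo --> (f z : (R[i])^o).

(* [f] is given by a formula meaningful off [S]; its values on [S], where the
   convention [x / 0 = 0] applies, are disregarded. *)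
Definition analytic_up_to_removable (R : realType) (D : set (R[i])^o)
    (S : set R[i]) (f : R[i] -> R[i]) :=
  exists2 g : R[i] -> R[i],
    analytic_on D g & forall z, D z -> ~ S z -> g z = f z.

(* The pair of integer sequences (lambda, mu), all of whose entries lie in
   [0, M] because of the interlacing inequalities. *)
Definition config (N M : nat) : Type :=
  (N.-tuple 'I_M.+1 * N.-1.-tuple 'I_M.+1)%type.

(* Indices start at 1, as in lambda_1, ..., lambda_N and mu_1, ..., mu_{N-1};
   values at other indices are junk. *)
Definition lambda (N M : nat) (x : config N M) (i : nat) : nat :=
  nth ord0 x.1 i.-1.
Definition mu (N M : nat) (x : config N M) (i : nat) : nat :=
  nth ord0 x.2 i.-1.
Definition ell (N M : nat) (x : config N M) (i : nat) : nat :=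
  (lambda x i + (N - i))%N.
Definition emm (N M : nat) (x : config N M) (i : nat) : nat :=
  (mu x i + (N - i))%N.

Definition interlacing (N M : nat) : {set config N M} :=
  [set x : config N M | [forall i : 'I_N.-1,
     (mu x i.+1 <= lambda x i.+1)%N && (lambda x i.+2 <= mu x i.+1)%N]].

Section Measure.

Context (R : realType) (N M : nat) (w tau : R -> R[i]).

Implicit Types (x : config N M) (A : pred (config N M))
  (F : config N M -> R[i]).

Definition weight x : R[i] :=
  (\prod_(1 <= j < N.+1) \prod_(1 <= i < j) ((ell x i)%:R - (ell x j)%:R)) *
  (\prod_(1 <= i < N.+1) w (ell x i)%:R) *
  (\prod_(1 <= j < N) \prod_(1 <= i < j) ((emm x i)%:R - (emm x j)%:R)) *
  (\prod_(1 <= i < N) tau (emm x i)%:R).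

Definition partition_function : R[i] := \sum_(x in interlacing N M) weight x.

Definition mass x : R[i] := weight x / partition_function.

Definition expect F : R[i] := \sum_(x in interlacing N M) F x * mass x.

Definition prob A : R[i] := \sum_(x in interlacing N M | A x) mass x.

(* P(A) E[F | A], that is, E[F 1_A]. *)
Definition expect_on A F : R[i] :=
  \sum_(x in interlacing N M | A x) F x * mass x.

Local Notation s := ((M + N)%:R : R[i]).

Section Observables.

Context (phi_t phi_b phi_m : R[i] -> R[i]).

Definition r1_minus : R[i] :=
  - phi_t 0 *
    expect_on (fun x => ell x N == 0%N)
      (fun x => \prod_(1 <= i < N) (((ell x i)%:R + 1) / (ell x i)%:R)).

Definition r1_plus : R[i] :=
  phi_b s *
    expect_on (fun x => emm x 1 == (M + N).-1%N)
      (fun x => \prod_(2 <= i < N)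
         ((s - (emm x i)%:R) / (s - (emm x i)%:R - 1))) +
  phi_m s * prob (fun x => ell x 1 == (M + N).-1%N).

Definition r2_minus : R[i] :=
  - phi_b 0 *
    expect_on (fun x => emm x N.-1 == 1%N)
      (fun x => \prod_(1 <= i < N.-1) ((emm x i)%:R / ((emm x i)%:R - 1))) -
  phi_m 0 * prob (fun x => ell x N == 0%N).

Definition r2_plus : R[i] :=
  phi_t s *
    expect_on (fun x => ell x 1 == (M + N).-1%N)
      (fun x => \prod_(2 <= i < N.+1)
         ((s - (ell x i)%:R) / (s - (ell x i)%:R - 1))).

Definition R1 (z : R[i]) : R[i] :=
  phi_t z * expect (fun x =>
    \prod_(1 <= i < N.+1) ((z - (ell x i)%:R - 1) / (z - (ell x i)%:R))) +
  phi_b z * expect (fun x =>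
    \prod_(1 <= i < N) ((z - (emm x i)%:R) / (z - (emm x i)%:R - 1))) +
  phi_m z * expect (fun x =>
    (\sum_(1 <= i < N.+1) (z - (ell x i)%:R - 1)^-1) -
    (\sum_(1 <= i < N) (z - (emm x i)%:R)^-1)) -
  r1_minus / z - r1_plus / (z - s).

Definition R2 (z : R[i]) : R[i] :=
  phi_t z * expect (fun x =>
    \prod_(1 <= i < N.+1) ((z - (ell x i)%:R) / (z - (ell x i)%:R - 1))) +
  phi_b z * expect (fun x =>
    \prod_(1 <= i < N) ((z - (emm x i)%:R) / (z - (emm x i)%:R + 1))) +
  phi_m z * expect (fun x =>
    (\sum_(1 <= i < N) (z - (emm x i)%:R)^-1) -
    (\sum_(1 <= i < N.+1) (z - (ell x i)%:R)^-1)) -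
  r2_minus / z - r2_plus / (z - s).

End Observables.

End Measure.

Arguments partition_function {R} N M w tau.
Arguments R1 {R} N M w tau phi_t phi_b phi_m z.
Arguments R2 {R} N M w tau phi_t phi_b phi_m z.

(* The points 0, 1, ..., M + N at which some denominator occurring in [R1] or
   [R2] vanishes. *)
Definition apparent_poles (R : realType) (N M : nat) : set R[i] :=
  [set z | exists2 k : nat, (k <= M + N)%N & z = k%:R].
Arguments apparent_poles R N M : clear implicits.

(* Main.v *)
Require Import Defs.
From mathcomp Require Import all_boot all_order all_algebra.
From mathcomp Require Import all_classical all_reals all_analysis.
From mathcomp Require Import complex.
From mathcomp Require Import zify ring lra.

Set Implicit Arguments.
Unset Strict Implicit.
Unset Printing Implicit Defensive.

Import Order.TTheory GRing.Theory Num.Theory.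
Import numFieldNormedType.Exports.
Local Open Scope classical_set_scope.
Local Open Scope ring_scope.
Local Open Scope complex_scope.

(** Both observables have the same shape. Let [s = M + N]. Expanding each
    product in partial fractions writes [R1] and [R2], off the points
    [0, ..., s], as an analytic function plus a sum of terms
    [h_k(z) / (z - k)], where
    [h_k = A_k phi_t + B_k phi_b + C_k phi_m - r_k] with constants
    [A_k], [B_k], [C_k] that are expectations, and [r_k] is the subtracted
    boundary term when [k] is [0] or [s], and zero otherwise. An analytic
    function vanishing at [k] is divisible by [z - k] ([analytic_divide]), so
    it suffices that [h_k(k) = 0] for every [k] ([removable_simple_poles]).

    At [k = 0] and [k = s] this is the definition of the boundary terms: only
    the extremal particles can contribute ([r1_minusE], [r1_plusE],
    [r2_minusE], [r2_plusE]).

    For [0 < k < s] it is a cancellation between configurations. View [ell]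
    and [m] as particles with [ell_1 >= m_1 > ell_2 >= m_2 > ...]. The residue
    of the first product at [k] comes from configurations with a particle
    [ell_i] at the pole [a']; by the relation between [phi_t], [phi_m] and [w],
    multiplying it by [phi_t(k)] turns the weight of the configuration, up to
    sign, into [phi_m(k)] times the weight of the configuration in which
    [ell_i] has been moved from [a'] to the adjacent position [a]
    ([polar_coef_move]). The second product does the same for the [m] particles, moved from [c'] to
    [c], and the [phi_m] term counts, with the opposite sign, the interlacing
    configurations that have a particle at [a] or [c]. Thus the residue is a
    signed sum of weights over all pairs [y] of particle families, where the
    sign tests whether [y], respectively [y] with one particle moved back, is
    interlacing. Moving [ell_i] from [a] to [a'] affects interlacing only if
    some [m_j] is at [c], and conversely; when both are present the two moved
    configurations are simultaneously interlacing, provided no two particles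
    of one family coincide. Coinciding particles have weight zero because of
    the Vandermonde factors, so the sum vanishes termwise in [y]
    ([moves_balance], [residue_cancel]).

    A boolean [b] distinguishes the two observables: [false] for [R1] and
    [true] for [R2]. *)

(** * Power series and removable poles *)

Section Analytic.

Context (R : realType).
Implicit Types (D : set (R[i])^o) (f g : R[i] -> R[i]) (a b z : R[i]).

Lemma geometric_half_cvg0 (e : R[i]) : 0 < e ->
  \forall n \near \oo, (2^-1 : R[i]) ^+ n < e.
Proof.
move=> e_gt0.
have [er er_gt0 ->] : exists2 r : R, 0 < r & e = r%:C.
  case: e e_gt0 => a b; rewrite ltcE /= => /andP[/eqP -> a_gt0].
  by exists a.
have half1 : `|2^-1 : R| < 1 by rewrite ger0_norm; lra.
have := @cvgr0Pnorm_lt _ _ _ _ _ (geometric (1 : R) 2^-1).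
move=> /(_ \oo _)[/(_ (cvg_geometric 1 half1)) /(_ er er_gt0)] H _.
near=> n.
have : `|geometric (1 : R) 2^-1 n| < er by near: n.
rewrite /geometric /= mul1r ger0_norm ?exprn_ge0 ?invr_ge0 ?ler0n //.
by rewrite -(ltcR (R := R)) rmorphXn fmorphV rmorph_nat.
Unshelve. all: by end_near. Qed.

Lemma pseries_ball f a (c : nat -> R[i]) :
  (\forall z \near (a : (R[i])^o),
     series (fun k => c k * (z - a) ^+ k : (R[i])^o) @ \oo --> (f z : (R[i])^o)) ->
  exists2 r : R[i], 0 < r & forall u, `|u| < r ->
     series (fun k => c k * u ^+ k : (R[i])^o) @ \oo --> (f (a + u) : (R[i])^o).
Proof.
move=> /nbhs_normP[r /= r_gt0 H]; exists r => // u u_lt.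
have := H (a + u); rewrite /ball_ /= opprD addrA subrr add0r normrN.
by rewrite (addrAC a) subrr add0r; apply.
Qed.

(** Analyticity in terms of balls in the increment [u]; together with
    [analytic_ball] this replaces neighbourhood filters by explicit radii. *)
Lemma ball_analytic D f :
  (forall a, D a -> exists (c : nat -> R[i]) (r : R[i]), 0 < r /\ forall u, `|u| < r ->
     series (fun k => c k * u ^+ k : (R[i])^o) @ \oo --> (f (a + u) : (R[i])^o)) ->
  analytic_on D f.
Proof.
move=> H a Da; have [c [r [r_gt0 Hc]]] := H a Da; exists c.
apply/nbhs_normP; exists r => // z; rewrite /ball_ /= distrC => /Hc.
by rewrite (addrC a) subrK.
Qed.

Lemma analytic_ball D f a : analytic_on D f -> D a ->
  exists (c : nat -> R[i]) (r : R[i]), 0 < r /\ forall u, `|u| < r ->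
     series (fun k => c k * u ^+ k : (R[i])^o) @ \oo --> (f (a + u) : (R[i])^o).
Proof.
move=> fan Da; have [c /pseries_ball[r r_gt0 H]] := fan a Da.
by exists c, r.
Qed.

(** Minima are awkward here because the order of [R[i]] is only partial. *)
Lemma common_radius (r s : R[i]) : 0 < r -> 0 < s ->
  exists t : R[i], [/\ 0 < t, t <= r & t <= s].
Proof.
move=> r_gt0 s_gt0.
have [rs|sr] := real_leP (gtr0_real r_gt0) (gtr0_real s_gt0).
  by exists r.
by exists s; split=> //; exact: ltW.
Qed.

Lemma analytic_cst D b : analytic_on D (fun=> b).
Proof.
apply: ball_analytic => a _; exists (fun k => if k is 0 then b else 0), 1; split=> // u _.
rewrite -cvg_shiftS /=; apply: cvg_near_cst; near=> n.
by rewrite /series /= big_nat_recl //= expr0 mulr1 big1 ?addr0// => i _; rewrite mul0r.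
Unshelve. all: by end_near. Qed.

Lemma analyticD D f g : analytic_on D f -> analytic_on D g ->
  analytic_on D (fun z => f z + g z).
Proof.
move=> fan gan; apply: ball_analytic => a Da.
have [c [r [r_gt0 Hc]]] := analytic_ball fan Da.
have [d [s [s_gt0 Hd]]] := analytic_ball gan Da.
have [t [t_gt0 tr ts]] := common_radius r_gt0 s_gt0.
exists (fun k => c k + d k), t; split=> [//|u ut].
have -> : series (fun k => (c k + d k) * u ^+ k : (R[i])^o) =
  series (fun k => c k * u ^+ k : (R[i])^o) + series (fun k => d k * u ^+ k : (R[i])^o).
  apply/funext => n; rewrite /series /= /GRing.add /= -big_split /=.
  by apply: eq_bigr => i _; rewrite mulrDl.
by apply: cvgD; [exact/Hc/(lt_le_trans ut)|exact/Hd/(lt_le_trans ut)].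
Qed.

Lemma analyticZ D f b : analytic_on D f -> analytic_on D (fun z => b * f z).
Proof.
move=> fan; apply: ball_analytic => a Da.
have [c [r [r_gt0 Hc]]] := analytic_ball fan Da.
exists (fun k => b * c k), r; split=> [//|u /Hc H].
have -> : series (fun k => b * c k * u ^+ k : (R[i])^o) =
  (fun n => b * series (fun k => c k * u ^+ k : (R[i])^o) n).
  apply/funext => n; rewrite /series /= big_distrr /=.
  by apply: eq_bigr => i _; rewrite mulrA.
exact: cvgMl_tmp.
Qed.

Lemma analytic_sum D (I : Type) (s : seq I) (F : I -> R[i] -> R[i]) :
  (forall i, analytic_on D (F i)) -> analytic_on D (fun z => \sum_(i <- s) F i z).
Proof.
move=> Fan; elim: s => [|i s IHs].
  rewrite (_ : (fun _ => _) = (fun=> 0)); first exact: analytic_cst.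
  by apply/funext => z; rewrite big_nil.
rewrite (_ : (fun _ => _) = (fun z => F i z + \sum_(i <- s) F i z)).
  exact: analyticD (Fan i) IHs.
by apply/funext => z; rewrite big_cons.
Qed.

(** If the series converges at [r], its terms there are bounded, which bounds
    the coefficients. *)
Lemma pseries_coef_bound (c : nat -> R[i]) (r l : R[i]) : 0 < r ->
  series (fun k => c k * r ^+ k : (R[i])^o) @ \oo --> (l : (R[i])^o) ->
  exists2 K : R[i], 0 < K & forall n, `|c n| <= K * r ^- n.
Proof.
move=> r_gt0 H.
have /cvg_series_cvg_0 : cvg (series (fun k => c k * r ^+ k : (R[i])^o) @ \oo).
  by apply/cvg_ex; exists l.
move=> /cvgr0Pnorm_lt/(_ 1 ltr01)[n0 _ Hn0].
exists (1 + \sum_(i < n0) `|c i * r ^+ i|).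
  by rewrite ltr_wpDr // sumr_ge0.
move=> n; rewrite ler_pdivlMr ?exprn_gt0//.
rewrite -{1}(ger0_norm (ltW r_gt0)) -normrX -normrM.
have [n0n|nn0] := leqP n0 n.
  by apply: ler_wpDr; [exact: sumr_ge0|exact: ltW (Hn0 _ n0n)].
rewrite (bigD1 (Ordinal nn0)) //= addrCA ler_wpDr// addr_ge0// sumr_ge0//.
Qed.

(** The coefficients of [f(a + u) / (u - d)], when [f(a + u)] has coefficients
    [c]: they are determined by [(u - d) * quotient = f(a + u)]. *)
Fixpoint quot_coef (c : nat -> R[i]) (d : R[i]) (n : nat) : R[i] :=
  if n is n'.+1 then (quot_coef c d n' - c n) / d else - c 0%N / d.

(** The partial sums satisfy the defining identity up to one last term, which
    [quot_coef_bound] makes tend to zero. *)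
Lemma series_quot_coef (c : nat -> R[i]) (d u : R[i]) (n : nat) : d != 0 ->
  (u - d) * (\sum_(k < n.+1) quot_coef c d k * u ^+ k) =
  \sum_(k < n.+1) c k * u ^+ k + quot_coef c d n * u ^+ n.+1.
Proof.
move=> d0; elim: n => [|n IHn].
  by rewrite !big_ord_recl !big_ord0 /= !expr0 expr1; field.
rewrite big_ord_recr [in RHS]big_ord_recr /= mulrDr IHn !exprS; field.
exact: d0.
Qed.

Lemma quot_coef_bound (c : nat -> R[i]) (d r K : R[i]) : 0 < r -> r <= `|d| / 2 ->
  0 < K -> (forall n, `|c n| <= K * r ^- n) ->
  forall n, `|quot_coef c d n| <= 2 * K / `|d| * r ^- n.
Proof.
move=> r_gt0 rd K_gt0 cK.
have d_gt0 : 0 < `|d|.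
  have : 0 < `|d| / 2 by exact: lt_le_trans rd.
  by rewrite pmulr_lgt0 // invr_gt0 ltr0n.
have r_neq0 : r != 0 by rewrite gt_eqF.
elim=> [|n IHn] /=.
  rewrite normrM normrN normfV expr0 invr1 mulr1 ler_pM2r ?invr_gt0//.
  apply: (le_trans (cK 0%N)); rewrite expr0 invr1 mulr1 mulr_natl mulr2n.
  by rewrite lerDl ltW.
rewrite normrM normfV mulrAC ler_pM2r ?invr_gt0//.
apply: le_trans (ler_normB _ _) _.
rewrite mulr_natl mulr2n mulrDl lerD//.
apply: le_trans IHn _.
have -> : 2 * K / `|d| * r ^- n = (K * r ^- n.+1) * (r / (`|d| / 2)).
  by rewrite exprS; field; rewrite r_neq0 expf_neq0 ?gt_eqF.
have Kr_ge0 : 0 <= K * r ^- n.+1.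
  by rewrite mulr_ge0 ?invr_ge0 ?exprn_ge0 ?(ltW K_gt0) ?(ltW r_gt0).
apply: ler_piMr => //; rewrite ler_pdivrMr ?mul1r//.
by rewrite divr_gt0 ?ltr0n.
Qed.

(** A zero of an analytic function can be divided out, on the whole of [D].
    Around [b] the coefficients are shifted; around any other point [a] the
    quotient has the coefficients [quot_coef], with [d = b - a]. *)
Lemma analytic_divide D f b : D b -> f b = 0 -> analytic_on D f ->
  exists2 g, analytic_on D g & forall z, z != b -> g z = f z / (z - b).
Proof.
move=> Db fb0 fan.
have [c0 [r0 [r0_gt0 Hc0]]] := analytic_ball fan Db.
exists (fun z => if z == b then c0 1%N else f z / (z - b)); last first.
  by move=> z /negbTE ->.
apply: ball_analytic => a Da.
have [->|ab] := eqVneq a b.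
  exists (fun k => c0 k.+1), r0; split=> [//|u ur].
  have [->|u0] := eqVneq u 0.
    rewrite addr0 eqxx -cvg_shiftS /=; apply: cvg_near_cst; near=> n.
    rewrite /series /= big_nat_recl //= expr0 mulr1 big1 ?addr0// => i _.
    by rewrite expr0n mulr0.
  have c00 : c0 0%N = 0.
    have := Hc0 0; rewrite normr0 addr0 fb0 => /(_ r0_gt0).
    rewrite -cvg_shiftS /= => H.
    have H' : [sequence series (fun k : nat => c0 k * 0 ^+ k : (R[i])^o) n.+1]_n
         @ \oo --> (c0 0%N : (R[i])^o).
      apply: cvg_near_cst; near=> n.
      rewrite /series /= big_nat_recl //= expr0 mulr1 big1 ?addr0// => i _.
      by rewrite expr0n mulr0.
    exact: (cvg_unique _ H' H).
  have -> : (b + u == b) = false.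
    by apply: contra_neqF u0 => /eqP; rewrite -[RHS]addr0 => /addrI.
  rewrite addrAC subrr add0r.
  have := Hc0 u ur; rewrite -cvg_shiftS /= => H.
  have -> : series (fun k => c0 k.+1 * u ^+ k : (R[i])^o) =
     (fun n => series (fun k => c0 k * u ^+ k : (R[i])^o) n.+1 * u^-1).
    apply/funext => n; rewrite /series /= big_nat_recl //= c00 mul0r add0r.
    rewrite big_distrl /=; apply: eq_bigr => i _.
    by rewrite exprS; field.
  exact: cvgMr_tmp.
have [c [r1 [r1_gt0 Hc]]] := analytic_ball fan Da.
have d_neq0 : b - a != 0 by rewrite subr_eq0 eq_sym.
have d_gt0 : 0 < `|b - a| by rewrite normr_gt0.
set d := b - a in d_neq0 d_gt0 *.
have hr1 : 0 < r1 / 2 by rewrite divr_gt0 ?ltr0n.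
have hd : 0 < `|d| / 2 by rewrite divr_gt0 ?ltr0n.
(* [r] lies inside the disc of convergence, and at most half way to the pole. *)
have [r [r_gt0 rr1' rd]] := common_radius hr1 hd.
have rr1 : r < r1.
  apply: le_lt_trans rr1' _.
  by rewrite ltr_pdivrMr ?ltr0n // mulr_natr mulr2n ltrDl.
have [|K K_gt0 HK] := @pseries_coef_bound c r (f (a + r)) r_gt0.
  by apply: Hc; rewrite gtr0_norm.
have bK := quot_coef_bound r_gt0 rd K_gt0 HK.
set K' := 2 * K / `|d| in bK.
have K'_gt0 : 0 < K' by rewrite divr_gt0 // mulr_gt0 // ltr0n.
exists (quot_coef c d), (r / 2); split; first by rewrite divr_gt0 ?ltr0n.
move=> u ur2.
have ur : `|u| < r.
  apply: lt_trans ur2 _.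
  by rewrite ltr_pdivrMr ?ltr0n // mulr_natr mulr2n ltrDl.
have ud : u - d != 0.
  rewrite subr_eq0; apply: contraTneq ur => ->.
  rewrite -real_leNgt ?gtr0_real//; apply: le_trans rd _.
  by rewrite ler_pdivrMr ?ltr0n // mulr_natr mulr2n lerDl ltW.
have -> : (a + u == b) = false.
  by apply: contra_neqF ud => /eqP aub; rewrite /d -aub; ring.
have -> : a + u - b = u - d by rewrite /d; ring.
rewrite -cvg_shiftS /=.
have -> : (fun n => series (fun k => quot_coef c d k * u ^+ k : (R[i])^o) n.+1) =
   (fun n => (series (fun k => c k * u ^+ k : (R[i])^o) n.+1
               + quot_coef c d n * u ^+ n.+1) / (u - d)).
  apply/funext => n; rewrite /series /= !big_mkord -series_quot_coef//.
  by rewrite mulrC mulKf.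
have quot0 : (fun n => quot_coef c d n * u ^+ n.+1 : (R[i])^o) @ \oo --> (0 : (R[i])^o).
  apply/cvgr0Pnorm_lt => e e_gt0.
  have Kr : 0 < K' * r by rewrite mulr_gt0.
  have /geometric_half_cvg0 : 0 < e / (K' * r) by rewrite divr_gt0.
  move=> H; near=> n.
  have : 2^-1 ^+ n < e / (K' * r) :> R[i] by near: n.
  rewrite ltr_pdivlMr// => /(le_lt_trans _); apply.
  rewrite normrM normrX exprS.
  have un : `|u| ^+ n <= (r / 2) ^+ n.
    by rewrite lerXn2r// ?nnegrE ?ltW// divr_gt0 ?ltr0n.
  apply: (@le_trans _ _ ((K' * r ^- n) * (r * (r / 2) ^+ n))).
    apply: ler_pM; [exact: normr_ge0|by rewrite mulr_ge0 ?exprn_ge0|exact: bK|].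
    by apply: ler_pM; [exact: normr_ge0|exact: exprn_ge0|exact: ltW|exact: un].
  rewrite le_eqVlt; apply/orP; left; apply/eqP.
  rewrite exprMn; field.
  by rewrite expf_neq0 ?gt_eqF.
have serS : (fun n => series (fun k => c k * u ^+ k : (R[i])^o) n.+1)
    @ \oo --> (f (a + u) : (R[i])^o).
  by rewrite (cvg_shiftS (series (fun k => c k * u ^+ k : (R[i])^o))); exact: Hc (lt_trans ur rr1).
have := @cvgD _ _ _ _ eventually_filter _ _ _ _ serS quot0; rewrite addr0.
exact: (@cvgMr_tmp _ _ _ eventually_filter _ _ (u - d)^-1).
Unshelve. all: by end_near. Qed.

(** If [f] is an analytic function plus quotients [h k z / (z - p k)] whose
    numerators vanish at their poles, all the poles of [f] are removable. *)
Lemma removable_simple_poles D (n : nat) (f : R[i] -> R[i])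
    (f0 : R[i] -> R[i]) (h : 'I_n -> R[i] -> R[i]) (p : 'I_n -> R[i]) (S : set R[i]) :
  analytic_on D f0 -> (forall k, analytic_on D (h k)) ->
  (forall k, D (p k)) -> (forall k, S (p k)) -> (forall k, h k (p k) = 0) ->
  (forall z, ~ S z -> f z = f0 z + \sum_k h k z / (z - p k)) ->
  analytic_up_to_removable D S f.
Proof.
move=> f0an han Dp Sp hp0 fE.
have /choice[g gP] : forall k, exists g, analytic_on D g /\
    forall z, z != p k -> g z = h k z / (z - p k).
  by move=> k; have [g gan gE] := analytic_divide (Dp k) (hp0 k) (han k); exists g.
exists (fun z => f0 z + \sum_k g k z).
  have gan k : analytic_on D (g k) := (gP k).1.
  exact: analyticD f0an (analytic_sum (index_enum 'I_n) gan).
move=> z _ Sz; rewrite fE//; congr (_ + _); apply: eq_bigr => k _.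
by apply: (gP k).2; apply: contra_notN Sz => /eqP ->.
Qed.

End Analytic.

(** * Partial fractions *)

(** By induction on the list. The new factor is
    [1 + (p a - q a) / (z - p a)], and the induction hypothesis is used at [z]
    and at [p a]. *)
Lemma prod_partial_fractions_seq (F : fieldType) (I : eqType) (p q : I -> F)
    (s : seq I) (z : F) : uniq s -> {in s &, injective p} ->
  (forall i, i \in s -> z != p i) ->
  \prod_(i <- s) ((z - q i) / (z - p i)) = 1 + \sum_(i <- s) (p i - q i) *
     (\prod_(j <- s | j != i) ((p i - q j) / (p i - p j))) / (z - p i).
Proof.
elim: s z => [|a s IHs] z /=; first by rewrite !big_nil addr0.
move=> /andP[as_ us] pinj zp.
have za : z - p a != 0 by rewrite subr_eq0 zp ?mem_head.
have pinj' : {in s &, injective p}.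
  by move=> i j si sj; apply: pinj; rewrite in_cons ?si ?sj orbT.
have zs i : i \in s -> z != p i by move=> si; rewrite zp // in_cons si orbT.
have pas i : i \in s -> p a != p i.
  move=> si; apply: contraNneq as_ => /pinj -> //; rewrite in_cons ?eqxx ?si ?orbT//.
rewrite !big_cons IHs// eqxx /=.
have prodN (E : I -> F) : \prod_(j <- s | j != a) E j = \prod_(j <- s) E j.
  rewrite big_seq_cond [RHS]big_seq; apply: eq_bigl => j.
  by case: (eqVneq j a) => [->|_]; rewrite ?andbT ?andbF ?(negbTE as_).
rewrite prodN IHs//.
have -> : \sum_(i <- s) (p i - q i) *
    (\prod_(j <- a :: s | j != i) ((p i - q j) / (p i - p j))) / (z - p i) =
  \sum_(i <- s) (p i - q a) / (p i - p a) * ((p i - q i) *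
    (\prod_(j <- s | j != i) ((p i - q j) / (p i - p j))) / (z - p i)).
  rewrite !big_seq; apply: eq_bigr => i si; rewrite big_cons.
  have -> /= : a != i by apply: contraNneq as_ => ->.
  by ring.
have -> : (z - q a) / (z - p a) = 1 + (p a - q a) / (z - p a) by field.
rewrite mulrDr mulr1 mulrDr mulr1 mulrDl -!addrA; congr (1 + (_ + _)).
rewrite [LHS]mulr_sumr [X in _ = X / _ + _]mulr_sumr [X in _ = X + _]mulr_suml -big_split /= !big_seq.
apply: eq_bigr => i si.
have h1 : z - p i != 0 by rewrite subr_eq0 zs.
have h2 : p a - p i != 0 by rewrite subr_eq0 pas.
have h3 : p i - p a != 0 by rewrite subr_eq0 eq_sym pas.
move: (\prod_(_ <- _ | _) _) => P; field.
by rewrite h1 h2 h3 za.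
Qed.

Lemma prod_partial_fractions (F : fieldType) (I : finType) (p q : I -> F) (z : F) :
  injective p -> (forall i, z != p i) ->
  \prod_i ((z - q i) / (z - p i)) = 1 + \sum_i (p i - q i) *
     (\prod_(j | j != i) ((p i - q j) / (p i - p j))) / (z - p i).
Proof.
move=> pinj zp; apply: prod_partial_fractions_seq => //.
  by rewrite /index_enum -enumT enum_uniq.
by move=> i j _ _; exact: pinj.
Qed.

Lemma group_poles (F : fieldType) (I : finType) (p : I -> nat) (c : I -> F)
    (s : nat) (z : F) : (forall i, (p i <= s)%N) ->
  \sum_i c i / (z - (p i)%:R) =
  \sum_(k < s.+1) (\sum_(i | p i == k) c i) / (z - k%:R).
Proof.
move=> ps.
rewrite (partition_big (fun i => inord (p i) : 'I_s.+1) xpredT) //=.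
apply: eq_bigr => k _; rewrite mulr_suml.
have eqk i : (inord (p i) == k) = (p i == k).
  by rewrite -val_eqE /= inordK // ltnS.
by rewrite (eq_bigl _ _ eqk); apply: eq_bigr => i /eqP ->.
Qed.

(** The coefficient of [1 / (z - k)] in the partial fraction expansion of
    [\prod_i (z - q i) / (z - p i)], for integral [p] and [q]; it is zero when
    no [p i] equals [k]. *)
Definition polar_coef (F : fieldType) (I : finType) (p q : I -> nat) (k : nat) : F :=
  \sum_(i | p i == k) ((p i)%:R - (q i)%:R) *
     \prod_(j | j != i) ((k%:R - (q j)%:R) / (k%:R - (p j)%:R)).

Lemma prod_polar (F : numFieldType) (I : finType) (p q : I -> nat) (s : nat) (z : F) :
  injective p -> (forall i, (p i <= s)%N) ->
  (forall k, (k <= s)%N -> z != k%:R) ->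
  \prod_i ((z - (q i)%:R) / (z - (p i)%:R)) =
  1 + \sum_(k < s.+1) polar_coef F p q k / (z - k%:R).
Proof.
move=> pinj ps zs.
rewrite (@prod_partial_fractions F I (fun i => (p i)%:R) (fun i => (q i)%:R)).
- rewrite (group_poles _ _ ps); congr (_ + _); apply: eq_bigr => k _; congr (_ / _).
  by apply: eq_bigr => i /eqP ->.
- by move=> i j /eqP; rewrite eqr_nat => /eqP/pinj.
- by move=> i; exact: zs.
Qed.

Lemma polar_coef_eq0 (F : fieldType) (I : finType) (p q : I -> nat) (k : nat) :
  (forall i, p i != k) -> polar_coef F p q k = 0.
Proof. by move=> pk; rewrite /polar_coef big_pred0// => i; exact: negbTE. Qed.

Lemma polar_coef_single (F : fieldType) (I : finType) (p q : I -> nat) (k : nat) i :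
  (forall j, p j = k -> j = i) ->
  polar_coef F p q k = if p i == k then (k%:R - (q i)%:R) *
    \prod_(j | j != i) ((k%:R - (q j)%:R) / (k%:R - (p j)%:R)) else 0.
Proof.
move=> pk; case: ifP => [/eqP pik|/negbT pik].
  rewrite /polar_coef (big_pred1 i) ?pik// => j /=.
  by apply/eqP/eqP => [/pk //|->].
by apply: polar_coef_eq0 => j; apply: contraNneq pik => /[dup] /pk -> ->.
Qed.

Lemma prod_neq_last (A : comPzSemiRingType) (n : nat) (f : nat -> A) :
  \prod_(j < n.+1 | j != ord_max) f j = \prod_(j < n) f j.
Proof.
rewrite big_mkcond big_ord_recr /= eqxx mulr1; apply: eq_bigr => j _.
by rewrite -val_eqE /= neq_ltn ltn_ord.
Qed.

Lemma prod_neq_first (A : comPzSemiRingType) (n : nat) (f : nat -> A) :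
  \prod_(j < n.+1 | j != ord0) f j = \prod_(j < n) f j.+1.
Proof. by rewrite big_mkcond big_ord_recl /= mul1r. Qed.

(** * Interlacing particles and elementary moves *)

(* [lia] after abstracting the integer values of all ordinals in the goal. *)
Ltac ord_lia := repeat match goal with
  |- context [nat_of_ord ?x] => move: (nat_of_ord x) => ? end; lia.

Section Particles.

Context (n s : nat).
Local Notation V := 'I_s.+1.
Local Notation T := ({ffun 'I_n.+1 -> V} * {ffun 'I_n -> V})%type.

(** A pair of particle families, [n.+1] top particles [ell = y.1] and [n]
    bottom particles [m = y.2], all in [0, s], is interlaced when
    [s > ell_0 >= m_0 > ell_1 >= m_1 > ... > ell_n]. Positions are allowed to
    be arbitrary, rather than constrained by interlacing, so that a single
    particle can always be moved. *)
Definition interlaced (y : T) : bool :=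
  (y.1 ord0 < s)%N && [forall i : 'I_n,
    (y.2 i <= y.1 (widen_ord (leqnSn n) i))%N && (y.1 (lift ord0 i) < y.2 i)%N].

(** The family [f] with its [i]-th particle put at [v]. *)
Definition relocate (I : finType) (f : {ffun I -> V}) (i : I) (v : V) : {ffun I -> V} :=
  [ffun j => if j == i then v else f j].

Lemma relocate_at (I : finType) (f : {ffun I -> V}) i v : relocate f i v i = v.
Proof. by rewrite ffunE eqxx. Qed.

Lemma relocate_relocate (I : finType) (f : {ffun I -> V}) i v v' :
  relocate (relocate f i v) i v' = relocate f i v'.
Proof. by apply/ffunP => j; rewrite !ffunE; case: eqP. Qed.

Lemma relocate_id (I : finType) (f : {ffun I -> V}) i v : (relocate f i v == f) = (f i == v).
Proof.
apply/eqP/eqP => [<-|<-]; first by rewrite relocate_at.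
by apply/ffunP => j; rewrite ffunE; case: eqP => [->|].
Qed.

(** The positions relevant to the residue at [k]: top particles sitting at [a']
    are moved to [a], and bottom particles sitting at [c'] are moved to [c].
    The two alternatives correspond to [R1] and [R2]. *)
Definition elementary_moves (k : nat) (a a' c c' : V) : Prop :=
  [/\ (0 < k < s)%N, c = k :> nat &
   [/\ a.+1 = k, a' = k :> nat & c'.+1 = k] \/ [/\ a = k :> nat, a'.+1 = k & c' = k.+1 :> nat]].

Section Moves.

Context (k : nat) (a a' c c' : V) (moves : elementary_moves k a a' c c').

Lemma interlaced_move_top (y : T) i : (forall j, y.2 j != c) -> y.1 i = a ->
  interlaced (relocate y.1 i a', y.2) = interlaced y.
Proof.
case: moves => k0s ck aa' ny ya; rewrite /interlaced /=; congr (_ && _).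
  by rewrite ffunE; case: eqVneq => [->|//]; rewrite ya; move: k0s ck; case: aa'; case; ord_lia.
apply: eq_forallb => j; rewrite !ffunE.
have yj : y.2 j != c :> nat by exact: ny.
case: eqVneq => [->|_]; case: eqVneq => [->|_]; rewrite ?ya;
  move: yj k0s ck; case: aa'; case; ord_lia.
Qed.

Lemma interlaced_move_bot (y : T) j : (forall i, y.1 i != a) -> y.2 j = c ->
  interlaced (y.1, relocate y.2 j c') = interlaced y.
Proof.
case: moves => k0s ck aa' ny yc; rewrite /interlaced /=; congr (_ && _).
have nya x : y.1 x != a :> nat by exact: ny.
apply: eq_forallb => i; rewrite !ffunE.
have := nya (widen_ord (leqnSn n) i); have := nya (lift ord0 i).
case: (eqVneq i j) => [->|_]; rewrite ?yc; move: k0s ck; case: aa'; case; ord_lia.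
Qed.

(** The two moved pairs are simultaneously interlaced: interlacing of both is
    checked slot by slot, and the slots where the two differ would force two
    particles of one family to coincide. *)
Lemma interlaced_move_both (y : T) i j : injective y.1 -> injective y.2 ->
  y.1 i = a -> y.2 j = c ->
  interlaced (relocate y.1 i a', y.2) = interlaced (y.1, relocate y.2 j c').
Proof.
case: moves => k0s ck aa' inj1 inj2 ya yc; rewrite /interlaced /=; congr (_ && _).
  by rewrite ffunE; case: eqVneq => [->|//]; rewrite ya; move: k0s ck; case: aa'; case; ord_lia.
have nya x : x != i -> y.1 x != a :> nat.
  by apply: contra_neq => /val_inj; rewrite -ya => /inj1.
have nyc x : x != j -> y.2 x != c :> nat.
  by apply: contra_neq => /val_inj; rewrite -yc => /inj2.
apply: eq_forallb => x; rewrite !ffunE.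
have := nya (widen_ord (leqnSn n) x); have := nya (lift ord0 x); have := nyc x.
have : widen_ord (leqnSn n) x != lift ord0 x by rewrite -val_eqE /= /bump; lia.
case: (eqVneq x j) => [->|_]; case: (eqVneq (widen_ord _ _) i) => [->|_];
  case: (eqVneq (lift _ _) i) => [->|_] //=;
  rewrite ?ya ?yc; rewrite ?eqxx //= => h0 h1 h2 h3;
  try (have {}h1 := h1 isT); try (have {}h2 := h2 isT); try (have {}h3 := h3 isT);
  move: h0 h1 h2 h3 k0s ck; case: aa'; case; ord_lia.
Qed.

Lemma sum_at (A : nmodType) (I : finType) (f : {ffun I -> V}) v (G : I -> A) i :
  injective f -> f i = v -> \sum_(j | f j == v) G j = G i.
Proof.
move=> finj fi; rewrite (big_pred1 i) // => j /=.
by rewrite -fi (inj_eq finj).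
Qed.

(** The pointwise cancellation. Each sum has at most one term; if only one of
    the two particles is present its move does not affect interlacing. *)
Lemma moves_balance (F : pzRingType) (y : T) : injective y.1 -> injective y.2 ->
  \sum_(i | y.1 i == a) ((interlaced y)%:R - (interlaced (relocate y.1 i a', y.2))%:R)
  + \sum_(j | y.2 j == c) ((interlaced (y.1, relocate y.2 j c'))%:R - (interlaced y)%:R)
  = 0 :> F.
Proof.
move=> inj1 inj2.
have [i /eqP yi|no1] := pickP [pred i | y.1 i == a]; last first.
  rewrite big_pred0// add0r big1// => j /eqP yj.
  rewrite interlaced_move_bot ?subrr// => i; exact: negbT (no1 i).
rewrite (sum_at _ inj1 yi).
have [j /eqP yj|no2] := pickP [pred j | y.2 j == c]; last first.
  rewrite [X in _ + X]big_pred0// addr0 interlaced_move_top ?subrr// => j; exact: negbT (no2 j).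
by rewrite (sum_at _ inj2 yj) (interlaced_move_both inj1 inj2 yi yj) addrA subrK subrr.
Qed.

End Moves.

(** Change of variable: summing over the moved configuration. *)
Lemma sum_move_top (F : nmodType) (W : T -> F) (a a' : V) :
  \sum_(y : T | interlaced y) \sum_(i | y.1 i == a') W (relocate y.1 i a, y.2) =
  \sum_(y : T) \sum_(i | y.1 i == a) if interlaced (relocate y.1 i a', y.2) then W y else 0.
Proof.
rewrite (exchange_big_dep xpredT) //= [RHS](exchange_big_dep xpredT) //=.
apply: eq_bigr => i _.
rewrite (reindex_onto (fun y : T => (relocate y.1 i a', y.2)) (fun y : T => (relocate y.1 i a, y.2))) /=.
  rewrite -big_mkcondr /=; apply: eq_big => [y|y].
    rewrite relocate_relocate relocate_at eqxx andbT andbC; congr (_ && _).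
    by rewrite -[RHS]relocate_id -!pair_eqE /= eqxx andbT.
  by rewrite !relocate_relocate => /andP[_ /eqP ->].
move=> [y1 y2] /= /andP[_ /eqP yi]; rewrite relocate_relocate; congr (_, _).
by apply/eqP; rewrite relocate_id yi.
Qed.

Lemma sum_move_bot (F : nmodType) (W : T -> F) (c c' : V) :
  \sum_(y : T | interlaced y) \sum_(i | y.2 i == c') W (y.1, relocate y.2 i c) =
  \sum_(y : T) \sum_(i | y.2 i == c) if interlaced (y.1, relocate y.2 i c') then W y else 0.
Proof.
rewrite (exchange_big_dep xpredT) //= [RHS](exchange_big_dep xpredT) //=.
apply: eq_bigr => i _.
rewrite (reindex_onto (fun y : T => (y.1, relocate y.2 i c')) (fun y : T => (y.1, relocate y.2 i c))) /=.
  rewrite -big_mkcondr /=; apply: eq_big => [y|y].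
    rewrite relocate_relocate relocate_at eqxx andbT andbC; congr (_ && _).
    by rewrite -[RHS]relocate_id -!pair_eqE /= eqxx.
  by rewrite !relocate_relocate => /andP[_ /eqP ->].
move=> [y1 y2] /= /andP[_ /eqP yi]; rewrite relocate_relocate; congr (_, _).
by apply/eqP; rewrite relocate_id yi.
Qed.

(** The combinatorial core: for any weight vanishing on pairs with coinciding
    particles, the four contributions to an interior residue add up to zero. *)
Lemma residue_cancel (F : pzRingType) (W : T -> F) k a a' c c' :
  elementary_moves k a a' c c' ->
  (forall y, W y != 0 -> injective y.1 /\ injective y.2) ->
  \sum_(y : T | interlaced y)
    (\sum_(i | y.1 i == a) W y - \sum_(i | y.1 i == a') W (relocate y.1 i a, y.2)
     + \sum_(j | y.2 j == c') W (y.1, relocate y.2 j c) - \sum_(j | y.2 j == c) W y) = 0.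
Proof.
move=> moves Winj.
rewrite sumrB big_split sumrB /= sum_move_top sum_move_bot.
rewrite [X in X - _ + _ - _]big_mkcond [X in _ - _ + _ - X]big_mkcond /=.
rewrite -!sumrB -big_split -sumrB /= big1// => y _.
have [->|/Winj[inj1 inj2]] := eqVneq (W y) 0.
  by rewrite !big1 => [|i|i|i|i] //; rewrite ?if_same ?subrr ?addr0 ?subrr.
have ifE (b : bool) : (if b then W y else 0) = b%:R * W y.
  by case: b; rewrite ?mul1r ?mul0r.
have ifsE (I : finType) (P : pred I) (b : bool) :
    (if b then \sum_(i | P i) W y else 0) = \sum_(i | P i) b%:R * W y.
  by case: b; [apply: eq_bigr => i _; rewrite mul1r|rewrite big1// => i _; rewrite mul0r].
rewrite -[RHS](mul0r (W y)) -[X in _ = X * _](moves_balance moves F inj1 inj2) !ifsE.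
rewrite mulrDl !mulr_suml -addrA; congr (_ + _).
  by rewrite -sumrB; apply: eq_bigr => i _; rewrite ifE -mulrBl.
by rewrite -sumrB; apply: eq_bigr => i _; rewrite ifE -mulrBl.
Qed.

End Particles.

(** * Weights of particle families *)

Section Weights.

Context (F : numFieldType) (s : nat).
Local Notation V := 'I_s.+1.

Definition vandermonde (m : nat) (f : {ffun 'I_m -> V}) : F :=
  \prod_(j < m) \prod_(i < m | (i < j)%N) ((f i)%:R - (f j)%:R).

Lemma vandermonde_inj m (f : {ffun 'I_m -> V}) : vandermonde f != 0 -> injective f.
Proof.
move=> /prodf_neq0 vf i j fij; apply: contra_eq fij.
wlog ij : i j / (i < j)%N => [IH|_].
  by rewrite neq_ltn => /orP[] h; [|rewrite eq_sym]; apply: IH; rewrite // neq_ltn h // orbT.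
have /prodf_neq0/(_ i ij) := vf j isT.
by rewrite subr_eq0 eqr_nat.
Qed.

(** Moving one particle multiplies the Vandermonde product by the same product
    of ratios that occurs in [polar_coef]. *)
Lemma vandermonde_move m (f : {ffun 'I_m -> V}) (i : 'I_m) (a a' : V) :
  injective f -> f i = a' ->
  vandermonde (relocate f i a) =
  \prod_(j | j != i) ((a%:R - (f j)%:R) / (a'%:R - (f j)%:R)) * vandermonde f.
Proof.
move=> finj fi.
pose H j : F := (a%:R - (f j)%:R) / (a'%:R - (f j)%:R).
(* [G x j] is the ratio of the new to the old factor of the pair [x < j]. *)
pose G x j : F := if j == i then H x else if x == i then H j else 1.
have a'f j : j != i -> a'%:R - (f j)%:R != 0 :> F.
  by rewrite subr_eq0 eqr_nat -fi val_eqE (inj_eq finj) eq_sym.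
have -> : vandermonde (relocate f i a) =
    (\prod_(j < m) \prod_(x < m | (x < j)%N) G x j) * vandermonde f.
  rewrite /vandermonde -big_split /=; apply: eq_bigr => j _.
  rewrite -big_split /=; apply: eq_bigr => x xj.
  rewrite !ffunE /G /H.
  have [ji|ji] := eqVneq j i.
    have xi : x != i by rewrite -ji neq_ltn xj.
    rewrite (negbTE xi) ji fi; field; exact: a'f.
  have [xi|xi] := eqVneq x i; last by rewrite mul1r.
  by rewrite xi fi; field; exact: a'f.
congr (_ * _); rewrite (bigD1 i) //=.
have -> : \prod_(x < m | (x < i)%N) G x i = \prod_(x < m | (x < i)%N) H x.
  by apply: eq_bigr => x _; rewrite /G eqxx.
have -> : \prod_(j < m | j != i) \prod_(x < m | (x < j)%N) G x j =
          \prod_(j < m | (i < j)%N) H j.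
  rewrite [RHS](bigID (fun j => j == i)) /= [X in _ = X * _]big1 ?mul1r; last first.
    by move=> j /andP [ij /eqP ji]; move: ij; rewrite ji ltnn.
  rewrite [RHS]big_mkcond /= big_mkcond /=; apply: eq_bigr => j _.
  rewrite andbC; case: eqVneq => //= ji.
  case: ifP => ij; last first.
    apply: big1 => x xj; rewrite /G (negbTE ji); case: eqP => // xi.
    by rewrite -xi xj in ij.
  rewrite (bigD1 i) //= /G (negbTE ji) eqxx big1 ?mulr1// => x /andP[_ /negbTE ->].
  by [].
rewrite [RHS](bigID (fun j : 'I_m => (j < i)%N)) /=; congr (_ * _); apply: eq_bigl => j.
  by rewrite neq_ltn; case: ltngtP.
by rewrite -(inj_eq val_inj) neq_ltn; case: ltngtP.
Qed.

(** The contribution of one particle family to the weight of a configuration,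
    [u] being its one-particle weight. *)
Definition species_weight (u : nat -> F) (m : nat) (f : {ffun 'I_m -> V}) : F :=
  vandermonde f * \prod_i u (f i).

Lemma species_weight_move (u : nat -> F) m (f : {ffun 'I_m -> V}) (i : 'I_m) (a a' : V) :
  injective f -> f i = a' -> u a' != 0 ->
  species_weight u (relocate f i a) = u a / u a' *
    \prod_(j | j != i) ((a%:R - (f j)%:R) / (a'%:R - (f j)%:R)) * species_weight u f.
Proof.
move=> finj fi ua'; rewrite /species_weight (vandermonde_move a finj fi).
have -> : \prod_j u (relocate f i a j) = u a * \prod_(j | j != i) u (f j).
  rewrite (bigD1 i) //= relocate_at; congr (_ * _).
  by apply: eq_bigr => j /negbTE ji; rewrite ffunE ji.
have -> : \prod_j u (f j) = u a' * \prod_(j | j != i) u (f j).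
  by rewrite (bigD1 i) //= fi.
by field.
Qed.

(** The residue at [k] of [\prod_i (z - q (f i)) / (z - p (f i))], times [phi]
    and the weight of [f], equals [psi * (a - a')] times the weight of the
    family with the particle at [a'] moved to [a]. *)
Lemma polar_coef_move (u : nat -> F) m (f : {ffun 'I_m -> V}) (p q : nat -> nat) (k : nat)
    (a a' : V) (phi psi : F) :
  injective f ->
  (forall i, (p (f i) == k) = (f i == a')) ->
  (forall i, k%:R - (q (f i))%:R = a%:R - (f i)%:R :> F) ->
  (forall i, k%:R - (p (f i))%:R = a'%:R - (f i)%:R :> F) ->
  (forall i, f i = a' -> u a' != 0 /\ phi = psi * (u a / u a')) ->
  phi * (polar_coef F (fun i => p (f i)) (fun i => q (f i)) k * species_weight u f) =
  psi * (a%:R - a'%:R) * \sum_(i | f i == a') species_weight u (relocate f i a).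
Proof.
move=> finj pk qk pk' H; rewrite /polar_coef (eq_bigl _ _ pk).
rewrite mulr_suml !mulr_sumr; apply: eq_bigr => i /eqP fi.
have [ua' ->] := H i fi.
rewrite (species_weight_move a finj fi ua').
have -> : (p (f i))%:R = k%:R :> F by apply/eqP; rewrite eqr_nat pk fi.
rewrite qk fi.
rewrite (eq_bigr (fun j => (a%:R - (f j)%:R) / (a'%:R - (f j)%:R))).
  by ring.
by move=> j _; rewrite qk pk'.
Qed.

End Weights.

(** * Order properties of interlaced pairs *)

Section InterlacedOrder.

Context (n s : nat).
Local Notation V := 'I_s.+1.
Local Notation T := ({ffun 'I_n.+1 -> V} * {ffun 'I_n -> V})%type.
Implicit Types y : T.

Lemma interlacedP y : interlaced y -> (y.1 ord0 < s)%N /\ forall i : 'I_n,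
  (y.2 i <= y.1 (widen_ord (leqnSn n) i))%N /\ (y.1 (lift ord0 i) < y.2 i)%N.
Proof. by move=> /andP[? /forallP H]; split=> // i; apply/andP/H. Qed.

Lemma interlaced_top_gap y (i j : 'I_n.+1) : interlaced y -> (i <= j)%N ->
  (y.1 j + (j - i) <= y.1 i)%N.
Proof.
move=> /interlacedP[_ H] ij.
have [d dE] : exists d, (i + d = j)%N by exists (j - i)%N; rewrite subnKC.
have -> : (j - i = d)%N by rewrite -dE addKn.
elim: d j {ij} dE => [|d IHd] j dE.
  have -> : j = i by apply: val_inj; rewrite /= -dE addn0.
  by rewrite addn0.
have jd : (i + d < n)%N by have := ltn_ord j; rewrite -dE addnS ltnS.
have [h1 h2] := H (Ordinal jd).
have h := IHd (widen_ord (leqnSn n) (Ordinal jd)) erefl.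
have jE : j = lift ord0 (Ordinal jd) by apply: val_inj; rewrite /= /bump -dE; lia.
by rewrite -jE in h2; move: h h1 h2; ord_lia.
Qed.

Lemma interlaced_top_decr y (i j : 'I_n.+1) : interlaced y -> (i < j)%N ->
  (y.1 j < y.1 i)%N.
Proof.
move=> yint ij; have := interlaced_top_gap yint (ltnW ij).
by move: ij; ord_lia.
Qed.

Lemma interlaced_bot_decr y (i j : 'I_n) : interlaced y -> (i < j)%N ->
  (y.2 j < y.2 i)%N.
Proof.
move=> yint ij; have [_ H] := interlacedP yint.
have [h1 _] := H j; have [_ h2] := H i.
have : (lift ord0 i <= widen_ord (leqnSn n) j)%N by rewrite /= /bump.
move/(interlaced_top_gap yint)=> h3; move: h1 h2 h3; ord_lia.
Qed.

Lemma decr_inj m (f : {ffun 'I_m -> V}) :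
  (forall i j : 'I_m, (i < j)%N -> (f j < f i)%N) -> injective f.
Proof.
move=> H i j fij; apply: val_inj; case: (ltngtP i j) => // /H; by rewrite fij ltnn.
Qed.

Lemma interlaced_top_inj y : interlaced y -> injective y.1.
Proof. by move=> yint; apply: decr_inj => i j; exact: interlaced_top_decr. Qed.

Lemma interlaced_bot_inj y : interlaced y -> injective y.2.
Proof. by move=> yint; apply: decr_inj => i j; exact: interlaced_bot_decr. Qed.

Lemma interlaced_top_lt y i : interlaced y -> (y.1 i < s)%N.
Proof.
move=> yint; have [h _] := interlacedP yint.
by have := @interlaced_top_gap y ord0 i yint (leq0n _); move: h; ord_lia.
Qed.

Lemma interlaced_bot_bounds y i : interlaced y -> (0 < y.2 i < s)%N.
Proof.
move=> yint; have [_ /(_ i)[h1 h2]] := interlacedP yint.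
have := interlaced_top_lt (widen_ord (leqnSn n) i) yint.
by move: h1 h2; ord_lia.
Qed.

End InterlacedOrder.

(** * Vanishing of the interior residues *)

Section Residues.

Context (F : numFieldType) (n s : nat) (w tau : nat -> F).
Local Notation V := 'I_s.+1.
Local Notation T := ({ffun 'I_n.+1 -> V} * {ffun 'I_n -> V})%type.
Implicit Types (y : T) (b : bool) (k v : nat).

(** In both observables a top particle at [v] contributes the factor
    [(z - zero_top b v) / (z - pole_top b v)] and a bottom particle at [v] the
    factor [(z - v) / (z - pole_bot b v)]. Bottom particles are at positive
    positions, so the truncated predecessor in [pole_bot] is harmless. *)
Definition pole_top b v : nat := v + b.
Definition zero_top b v : nat := v + ~~ b.
Definition pole_bot b v : nat := if b then v.-1 else v.+1.

Definition pair_weight y : F := species_weight w y.1 * species_weight tau y.2.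

(** The unnormalized coefficients of [phi_t], [phi_b] and [phi_m] in the
    residue at [k]. *)
Definition top_residue b k : F := \sum_(y : T | interlaced y)
  polar_coef F (fun i => pole_top b (y.1 i)) (fun i => zero_top b (y.1 i)) k * pair_weight y.
Definition bot_residue b k : F := \sum_(y : T | interlaced y)
  polar_coef F (fun i => pole_bot b (y.2 i)) (fun i => y.2 i : nat) k * pair_weight y.
Definition mid_residue b k : F := \sum_(y : T | interlaced y)
  (-1) ^+ b * (\sum_(i | zero_top b (y.1 i) == k) 1 - \sum_(i | y.2 i == k :> nat) 1)
    * pair_weight y.

Lemma interior_residue b k (phi_t phi_b phi_m : F) : (0 < k < s)%N ->
  (forall v, (v < s)%N -> w v != 0) ->
  (forall v, (0 < v < s)%N -> tau v != 0) ->
  phi_t = phi_m * (if b then w k / w k.-1 else w k.-1 / w k) ->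
  (if b then (k.+1 < s)%N -> phi_b = phi_m * (tau k / tau k.+1)
   else (1 < k)%N -> phi_b = phi_m * (tau k / tau k.-1)) ->
  phi_t * top_residue b k + phi_b * bot_residue b k + phi_m * mid_residue b k = 0.
Proof.
move=> k0s w0 tau0 phitE phibE.
pose a : V := inord (if b then k else k.-1).
pose a' : V := inord (if b then k.-1 else k).
pose c : V := inord k.
pose c' : V := inord (if b then k.+1 else k.-1).
have aE : a = (if b then k else k.-1) :> nat by rewrite inordK //; case: (b); lia.
have a'E : a' = (if b then k.-1 else k) :> nat by rewrite inordK //; case: (b); lia.
have cE : c = k :> nat by rewrite inordK //; lia.
have c'E : c' = (if b then k.+1 else k.-1) :> nat by rewrite inordK //; case: (b); lia.
have moves : elementary_moves k a a' c c'.
  split=> //; rewrite aE a'E c'E; case: (b); [right|left]; split; lia.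
have cancel := @residue_cancel n s F pair_weight k a a' c c' moves.
have top y : interlaced y -> phi_t * (polar_coef F (fun i => pole_top b (y.1 i))
      (fun i => zero_top b (y.1 i)) k * pair_weight y) =
    phi_m * (- (-1) ^+ b) * \sum_(i | y.1 i == a') pair_weight (relocate y.1 i a, y.2).
  move=> yint; rewrite /pair_weight mulrA mulrA -[_ * species_weight w _]mulrA.
  have -> : - (-1) ^+ b = a%:R - a'%:R :> F.
    rewrite aE a'E; case: (b) => /=; have := k0s; case: (k) => [|k1] //= _; rewrite -natr1; ring.
  rewrite (@polar_coef_move _ _ w _ _ (pole_top b) (zero_top b) k a a' phi_t phi_m).
  - by rewrite -mulrA mulr_suml.
  - exact: interlaced_top_inj.
  - move=> i; rewrite -val_eqE /= a'E /pole_top; move: k0s; case: (b); ord_lia.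
  - move=> i; rewrite /zero_top natrD aE; have := k0s; case: (b) => /=; first by rewrite addr0.
    by case: (k) => [|k1] //= _; rewrite -[k1.+1%:R]natr1; ring.
  - move=> i; rewrite /pole_top natrD a'E; have := k0s; case: (b) => /=; last by rewrite addr0.
    by case: (k) => [|k1] //= _; rewrite -[k1.+1%:R]natr1; ring.
  - move=> i _; split; first by apply: w0; rewrite a'E; move: k0s; case: (b); lia.
    by rewrite phitE aE a'E; case: (b).
have bot y : interlaced y -> phi_b * (polar_coef F (fun i => pole_bot b (y.2 i))
      (fun i => y.2 i : nat) k * pair_weight y) =
    phi_m * (-1) ^+ b * \sum_(i | y.2 i == c') pair_weight (y.1, relocate y.2 i c).
  move=> yint; rewrite /pair_weight [species_weight w _ * _]mulrC mulrA mulrA -[_ * species_weight tau _]mulrA.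
  have -> : (-1) ^+ b = c%:R - c'%:R :> F.
    rewrite cE c'E; case: (b) => /=; have := k0s; case: (k) => [|k1] //= _; rewrite -natr1; ring.
  rewrite (@polar_coef_move _ _ tau _ _ (pole_bot b) id k c c' phi_b phi_m).
  - rewrite -mulrA mulr_suml; congr (_ * _); apply: eq_bigr => i _; exact: mulrC.
  - exact: interlaced_bot_inj.
  - move=> i; have := interlaced_bot_bounds i yint.
    rewrite -val_eqE /= c'E /pole_bot; move: k0s; case: (b); ord_lia.
  - by move=> i; rewrite cE.
  - move=> i; have := interlaced_bot_bounds i yint; rewrite c'E /pole_bot.
    move: (nat_of_ord (y.2 i)) k0s => [|v] // k0s _; case: (b) => /=.
      by rewrite -[v.+1%:R]natr1 -natr1; ring.
    case: (k) k0s => [|k1] //= _; rewrite -!natr1; ring.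
  - move=> i yi; have := interlaced_bot_bounds i yint; rewrite yi => c'b; split.
      exact: tau0.
    move: phibE c'b; rewrite cE c'E; case: (b) => phibE c'b; apply: phibE; move: c'b k0s; lia.
rewrite /top_residue /bot_residue /mid_residue !mulr_sumr -!big_split /=.
rewrite -[RHS](mulr0 (phi_m * (-1) ^+ b)) -[X in _ = _ * X]cancel; last first.
  move=> y; rewrite /pair_weight /species_weight !mulf_eq0 !negb_or.
  by move=> /andP[/andP[h1 _] /andP[h2 _]]; split; [exact: (vandermonde_inj h1)|exact: (vandermonde_inj h2)].
rewrite mulr_sumr; apply: eq_bigr => y yint.
rewrite top // bot //.
have -> : \sum_(i | y.1 i == a) pair_weight y =
    (\sum_(i | zero_top b (y.1 i) == k) 1) * pair_weight y.
  rewrite mulr_suml; apply: eq_big => [i|i _]; last by rewrite mul1r.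
  by rewrite -val_eqE /= aE /zero_top; move: k0s; case: (b); ord_lia.
have -> : \sum_(i | y.2 i == c) pair_weight y =
    (\sum_(i | y.2 i == k :> nat) 1) * pair_weight y.
  rewrite mulr_suml; apply: eq_big => [i|i _]; last by rewrite mul1r.
  by rewrite -val_eqE /= cE.
ring.
Qed.

End Residues.

(** * Configurations as interlaced pairs *)

Section Encoding.

Context (n M : nat).
Local Notation s := (M + n.+1)%N.
Local Notation V := 'I_s.+1.
Local Notation T := ({ffun 'I_n.+1 -> V} * {ffun 'I_n -> V})%type.
Local Notation X := (config n.+1 M).
Implicit Types (x : X) (y : T).

Lemma ellE x (i : 'I_n.+1) : ell x i.+1 = (tnth x.1 i + (n - i))%N.
Proof. by rewrite /ell /lambda (tnth_nth ord0) subSS. Qed.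

Lemma emmE x (i : 'I_n) : emm x i.+1 = (tnth (x.2 : n.-tuple _) i + (n - i))%N.
Proof. by rewrite /emm /mu (tnth_nth ord0) subSS. Qed.

(** The pair of particle families [(ell, m)] of a configuration, with indices
    starting at [0]. *)
Definition encode x : T :=
  ([ffun i : 'I_n.+1 => inord (ell x i.+1)], [ffun i : 'I_n => inord (emm x i.+1)]).

(** Recovers [lambda] and [mu]; an inverse of [encode] on interlaced pairs, the
    only ones for which the truncations do not matter. *)
Definition decode y : X :=
  ([tuple inord (y.1 i - (n - i)) | i < n.+1], [tuple inord (y.2 i - (n - i)) | i < n]).

Lemma encode_top x i : (encode x).1 i = ell x i.+1 :> nat.
Proof.
rewrite ffunE inordK // ellE; have := ltn_ord (tnth x.1 i); lia.
Qed.

Lemma encode_bot x i : (encode x).2 i = emm x i.+1 :> nat.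
Proof.
rewrite ffunE inordK // emmE; have := ltn_ord (tnth (x.2 : n.-tuple _) i); lia.
Qed.

Lemma encodeK : cancel encode decode.
Proof.
move=> x; rewrite /decode; case: x (encode_top x) (encode_bot x) => x1 x2 h1 h2.
congr (_, _); apply: eq_from_tnth => i; rewrite tnth_mktuple; apply: val_inj => /=.
  by rewrite h1 ellE addnK inordK.
by rewrite h2 emmE addnK inordK.
Qed.

Lemma interlaced_encode x : interlaced (encode x) = (x \in interlacing n.+1 M).
Proof.
rewrite inE /interlaced encode_top.
have -> /= : (ell x (ord0 : 'I_n.+1).+1 < s)%N.
  by rewrite ellE; have := ltn_ord (tnth x.1 ord0); lia.
apply: eq_forallb => i; rewrite encode_bot !encode_top /ell /emm /=.
move: (ltn_ord i); rewrite /bump /= add1n.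
by move: (lambda x i.+1) (lambda x i.+2) (mu x i.+1) => u v t; lia.
Qed.

Lemma decodeK y : interlaced y -> encode (decode y) = y.
Proof.
move=> yint.
have top (i : 'I_n.+1) : (n - i <= y.1 i)%N /\ (y.1 i - (n - i) <= M)%N.
  have := @interlaced_top_gap _ _ y i ord_max yint (leq_ord i).
  have := @interlaced_top_gap _ _ y ord0 i yint (leq0n i).
  have := interlaced_top_lt ord0 yint; have := ltn_ord i => /=.
  by ord_lia.
case: y yint top => y1 y2 /= yint top.
have bot (i : 'I_n) : (n - i <= y2 i)%N /\ (y2 i - (n - i) <= M)%N.
  have [_ /(_ i)/=[]] := interlacedP yint.
  have := top (widen_ord (leqnSn n) i); have := top (lift ord0 i); rewrite /= /bump /=.
  by have := ltn_ord i; ord_lia.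
rewrite /encode; congr (_, _); apply/ffunP => i; rewrite ffunE.
  have [h1 h2] := top i.
  by rewrite ellE tnth_mktuple (inordK (h2 : _ < M.+1)%N) subnK// inord_val.
have [h1 h2] := bot i.
by rewrite emmE tnth_mktuple (inordK (h2 : _ < M.+1)%N) subnK// inord_val.
Qed.

Lemma sum_encode (A : nmodType) (G : T -> A) :
  \sum_(y | interlaced y) G y = \sum_(x in interlacing n.+1 M) G (encode x).
Proof.
rewrite (reindex_onto encode decode) /=; last by move=> y; exact: decodeK.
by apply: eq_bigl => x; rewrite interlaced_encode encodeK eqxx andbT.
Qed.

Lemma prod_nat1_ord (A : comPzSemiRingType) (m : nat) (f : nat -> A) :
  \prod_(1 <= i < m.+1) f i = \prod_(i < m) f i.+1.
Proof. by rewrite big_add1 big_mkord. Qed.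

Lemma sum_nat1_ord (A : nmodType) (m : nat) (f : nat -> A) :
  \sum_(1 <= i < m.+1) f i = \sum_(i < m) f i.+1.
Proof. by rewrite big_add1 big_mkord. Qed.

Lemma weight_encode (R : realType) (w tau : R -> R[i]) x :
  weight w tau x =
  pair_weight (fun v => w v%:R) (fun v => tau v%:R) (encode x).
Proof.
rewrite /weight !prod_nat1_ord /pair_weight /species_weight -!mulrA.
have vE (m : nat) (f : nat -> nat) (g : {ffun 'I_m -> V}) :
    (forall i : 'I_m, g i = f i.+1 :> nat) ->
    \prod_(j < m) \prod_(1 <= i < j.+1) ((f i)%:R - (f j.+1)%:R) = vandermonde R[i] g.
  move=> gf; apply: eq_bigr => j _.
  rewrite prod_nat1_ord (big_ord_widen m (fun i => (f i.+1)%:R - (f j.+1)%:R)).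
    by apply: eq_bigr => i _; rewrite !gf.
  exact: ltnW.
rewrite (vE _ _ (encode x).1 (encode_top x)) (vE _ _ (encode x).2 (encode_bot x)).
congr (_ * (_ * (_ * _))); apply: eq_bigr => i _.
  by rewrite encode_top.
by rewrite encode_bot.
Qed.

End Encoding.

(** * Pole expansion of the observables *)

Section Observables.

Context (R : realType) (n M : nat) (w tau : R -> R[i]).
Local Notation s := (M + n.+1)%N.
Local Notation X := (config n.+1 M).
Implicit Types (x : X) (b : bool) (k : nat).

Local Notation mass := (@mass R n.+1 M w tau).
Local Notation expect := (@expect R n.+1 M w tau).
Local Notation Z := (partition_function n.+1 M w tau).
Local Notation wn := (fun v : nat => w v%:R).
Local Notation taun := (fun v : nat => tau v%:R).

Section Order.

Context (x : X) (xI : x \in interlacing n.+1 M).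

Let yI : interlaced (encode x). Proof. by rewrite interlaced_encode. Qed.

Lemma ell_decr (i j : 'I_n.+1) : (i < j)%N -> (ell x j.+1 < ell x i.+1)%N.
Proof. by move=> ij; rewrite -!encode_top; exact: interlaced_top_decr. Qed.

Lemma emm_decr (i j : 'I_n) : (i < j)%N -> (emm x j.+1 < emm x i.+1)%N.
Proof. by move=> ij; rewrite -!encode_bot; exact: interlaced_bot_decr. Qed.

Lemma ell_lt (i : 'I_n.+1) : (ell x i.+1 < s)%N.
Proof. by rewrite -encode_top; exact: interlaced_top_lt. Qed.

Lemma emm_bounds (i : 'I_n) : (0 < emm x i.+1 < s)%N.
Proof. by rewrite -encode_bot; exact: interlaced_bot_bounds. Qed.

Lemma ell_inj : injective (fun i : 'I_n.+1 => ell x i.+1).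
Proof.
move=> i j ij; apply: val_inj; case: (ltngtP i j) => // /ell_decr; by rewrite ij ltnn.
Qed.

Lemma emm_inj : injective (fun i : 'I_n => emm x i.+1).
Proof.
move=> i j ij; apply: val_inj; case: (ltngtP i j) => // /emm_decr; by rewrite ij ltnn.
Qed.

Lemma ell_bound (i : 'I_n.+1) : (n - i <= ell x i.+1 < s - i)%N.
Proof.
rewrite -encode_top; have := @interlaced_top_gap _ _ _ i ord_max yI (leq_ord i).
have := @interlaced_top_gap _ _ _ ord0 i yI (leq0n i).
have := interlaced_top_lt ord0 yI; rewrite /=; ord_lia.
Qed.

End Order.

(** The coefficients of [phi_t], [phi_b] and [phi_m] in the residue at [k]. *)
Definition top_coef b k : R[i] := \sum_(x in interlacing n.+1 M)
  polar_coef R[i] (fun i : 'I_n.+1 => pole_top b (ell x i.+1))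
    (fun i : 'I_n.+1 => zero_top b (ell x i.+1)) k * mass x.
Definition bot_coef b k : R[i] := \sum_(x in interlacing n.+1 M)
  polar_coef R[i] (fun i : 'I_n => pole_bot b (emm x i.+1))
    (fun i : 'I_n => emm x i.+1) k * mass x.
Definition mid_coef b k : R[i] := \sum_(x in interlacing n.+1 M)
  (-1) ^+ b * (\sum_(i < n.+1 | zero_top b (ell x i.+1) == k) 1 -
               \sum_(i < n | emm x i.+1 == k) 1) * mass x.

Lemma top_coefE b k : top_coef b k = top_residue n s wn taun b k / Z.
Proof.
rewrite /top_coef /top_residue sum_encode mulr_suml; apply: eq_bigr => x _ /=.
have -> : (fun i => pole_top b ((encode x).1 i)) = (fun i => pole_top b (ell x i.+1)).
  by apply/funext => i; rewrite encode_top.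
have -> : (fun i => zero_top b ((encode x).1 i)) = (fun i => zero_top b (ell x i.+1)).
  by apply/funext => i; rewrite encode_top.
by rewrite /mass weight_encode mulrA.
Qed.

Lemma bot_coefE b k : bot_coef b k = bot_residue n s wn taun b k / Z.
Proof.
rewrite /bot_coef /bot_residue sum_encode mulr_suml; apply: eq_bigr => x _ /=.
have -> : (fun i => pole_bot b ((encode x).2 i)) = (fun i => pole_bot b (emm x i.+1)).
  by apply/funext => i; rewrite encode_bot.
have -> : (fun i => (encode x).2 i : nat) = (fun i => emm x i.+1).
  by apply/funext => i; rewrite encode_bot.
by rewrite /mass weight_encode mulrA.
Qed.

Lemma mid_coefE b k : mid_coef b k = mid_residue n s wn taun b k / Z.
Proof.
rewrite /mid_coef /mid_residue sum_encode mulr_suml; apply: eq_bigr => x _ /=.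
have -> : \sum_(i < n.+1 | zero_top b ((encode x).1 i) == k) 1 =
    \sum_(i < n.+1 | zero_top b (ell x i.+1) == k) 1 :> R[i].
  by apply: eq_bigl => i; rewrite encode_top.
have -> : \sum_(i < n | (encode x).2 i == k :> nat) 1 =
    \sum_(i < n | emm x i.+1 == k) 1 :> R[i].
  by apply: eq_bigl => i; rewrite encode_bot.
by rewrite /mass weight_encode mulrA.
Qed.

(** The common form of [R1] ([b = false]) and [R2] ([b = true]), with arbitrary
    constants [rm] and [rp] for the boundary terms at [0] and [s]. *)
Definition observable b (pt pb pm : R[i] -> R[i]) (rm rp : R[i]) (z : R[i]) : R[i] :=
  pt z * expect (fun x => \prod_(i < n.+1)
     ((z - (zero_top b (ell x i.+1))%:R) / (z - (pole_top b (ell x i.+1))%:R))) +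
  pb z * expect (fun x => \prod_(i < n)
     ((z - (emm x i.+1)%:R) / (z - (pole_bot b (emm x i.+1))%:R))) +
  pm z * expect (fun x => (-1) ^+ b *
     (\sum_(i < n.+1) (z - (zero_top b (ell x i.+1))%:R)^-1 -
      \sum_(i < n) (z - (emm x i.+1)%:R)^-1)) -
  rm / z - rp / (z - s%:R).

Lemma expect_expansion (F : X -> R[i]) (e : R[i]) (c : nat -> X -> R[i]) (z : R[i]) :
  (forall x, x \in interlacing n.+1 M ->
     F x = e + \sum_(k < s.+1) c k x / (z - k%:R)) ->
  expect F = e * expect (fun=> 1) + \sum_(k < s.+1)
     (\sum_(x in interlacing n.+1 M) c k x * mass x) / (z - k%:R).
Proof.
move=> FE; rewrite /Defs.expect mulr_sumr.
have -> : \sum_(k < s.+1) (\sum_(x in interlacing n.+1 M) c k x * mass x) / (z - k%:R) =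
  \sum_(x in interlacing n.+1 M) \sum_(k < s.+1) c k x / (z - k%:R) * mass x.
  rewrite exchange_big /=; apply: eq_bigr => k _; rewrite mulr_suml.
  by apply: eq_bigr => x _; rewrite mulrAC.
rewrite -big_split /=; apply: eq_bigr => x xI.
by rewrite FE// mulrDl mulr_suml mul1r.
Qed.

Lemma observable_expansion b (pt pb pm : R[i] -> R[i]) (rm rp z : R[i]) :
  (forall k, (k <= s)%N -> z != k%:R) ->
  observable b pt pb pm rm rp z =
  (expect (fun=> 1) * pt z + expect (fun=> 1) * pb z) +
  \sum_(k < s.+1) (top_coef b k * pt z + (bot_coef b k * pb z + (mid_coef b k * pm z
     + (if k == 0 :> nat then - rm else if k == s :> nat then - rp else 0))))
     / (z - k%:R).
Proof.
move=> zs; rewrite /observable.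
have -> : expect (fun x => \prod_(i < n.+1)
    ((z - (zero_top b (ell x i.+1))%:R) / (z - (pole_top b (ell x i.+1))%:R))) =
  1 * expect (fun=> 1) + \sum_(k < s.+1) top_coef b k / (z - k%:R).
  apply: (@expect_expansion _ 1 (fun k x => polar_coef R[i]
    (fun i : 'I_n.+1 => pole_top b (ell x i.+1))
    (fun i : 'I_n.+1 => zero_top b (ell x i.+1)) k)) => x xI.
  apply: (@prod_polar _ _ (fun i : 'I_n.+1 => pole_top b (ell x i.+1))
    (fun i : 'I_n.+1 => zero_top b (ell x i.+1)) s z _ _ zs).
    by move=> i j /addIn; exact: ell_inj.
  by move=> i; have := ell_lt xI i; rewrite /pole_top; case: (b); lia.
have -> : expect (fun x => \prod_(i < n)
    ((z - (emm x i.+1)%:R) / (z - (pole_bot b (emm x i.+1))%:R))) =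
  1 * expect (fun=> 1) + \sum_(k < s.+1) bot_coef b k / (z - k%:R).
  apply: (@expect_expansion _ 1 (fun k x => polar_coef R[i]
    (fun i : 'I_n => pole_bot b (emm x i.+1)) (fun i : 'I_n => emm x i.+1) k)) => x xI.
  apply: (@prod_polar _ _ (fun i : 'I_n => pole_bot b (emm x i.+1))
    (fun i : 'I_n => emm x i.+1) s z _ _ zs).
    move=> i j; have := emm_bounds xI i; have := emm_bounds xI j.
    move=> hj hi h; apply: (emm_inj xI); move: h hi hj; rewrite /pole_bot; case: (b); lia.
  by move=> i; have := emm_bounds xI i; rewrite /pole_bot; case: (b); lia.
have -> : expect (fun x => (-1) ^+ b *
     (\sum_(i < n.+1) (z - (zero_top b (ell x i.+1))%:R)^-1 -
      \sum_(i < n) (z - (emm x i.+1)%:R)^-1)) =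
  0 * expect (fun=> 1) + \sum_(k < s.+1) mid_coef b k / (z - k%:R).
  apply: (@expect_expansion _ 0 (fun k x => (-1) ^+ b *
    (\sum_(i < n.+1 | zero_top b (ell x i.+1) == k) 1 -
     \sum_(i < n | emm x i.+1 == k) 1))) => x xI.
  rewrite add0r.
  have -> : \sum_(i < n.+1) (z - (zero_top b (ell x i.+1))%:R)^-1 =
     \sum_(i < n.+1) 1 / (z - (zero_top b (ell x i.+1))%:R).
    by apply: eq_bigr => i _; rewrite mul1r.
  have -> : \sum_(i < n) (z - (emm x i.+1)%:R)^-1 =
     \sum_(i < n) 1 / (z - (emm x i.+1)%:R).
    by apply: eq_bigr => i _; rewrite mul1r.
  rewrite (@group_poles _ _ (fun i : 'I_n.+1 => zero_top b (ell x i.+1)) (fun=> 1) s).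
    rewrite (@group_poles _ _ (fun i : 'I_n => emm x i.+1) (fun=> 1) s).
      by rewrite -sumrB mulr_sumr; apply: eq_bigr => k _; rewrite -mulrBl mulrA.
    by move=> i; have := emm_bounds xI i; lia.
  by move=> i; have := ell_lt xI i; rewrite /zero_top; case: (b); lia.
have -> : rm / z = \sum_(k < s.+1) (if k == 0 :> nat then rm else 0) / (z - k%:R).
  rewrite big_ord_recl /= subr0 big1 ?addr0// => k _.
  by rewrite mul0r.
have -> : rp / (z - s%:R) = \sum_(k < s.+1) (if k == s :> nat then rp else 0) / (z - k%:R).
  rewrite big_ord_recr /= eqxx big1 ?add0r// => k _.
  by rewrite ltn_eqF ?mul0r.
transitivity (expect (fun=> 1) * pt z + expect (fun=> 1) * pb z +
  (\sum_(k < s.+1) pt z * (top_coef b k / (z - k%:R)) +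
   \sum_(k < s.+1) pb z * (bot_coef b k / (z - k%:R)) +
   \sum_(k < s.+1) pm z * (mid_coef b k / (z - k%:R)) -
   \sum_(k < s.+1) (if k == 0 :> nat then rm else 0) / (z - k%:R) -
   \sum_(k < s.+1) (if k == s :> nat then rp else 0) / (z - k%:R))).
  by rewrite -!mulr_sumr; ring.
congr (_ + _).
rewrite -!big_split -!sumrB /=; apply: eq_bigr => k _.
have [k0|k0] := eqVneq (k : nat) 0%N.
  have -> : (k == s :> nat) = false by rewrite k0; lia.
  by ring.
by case: eqP => _; ring.
Qed.

(** It suffices that the residue vanishes at the interior points, and that the
    boundary constants are the residues at [0] and [s]. *)
Lemma observable_removable (D : set (R[i])^o) b (pt pb pm : R[i] -> R[i]) (rm rp : R[i]) :
  analytic_on D pt -> analytic_on D pb -> analytic_on D pm ->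
  (forall k, (k <= s)%N -> D k%:R) ->
  (forall k, (0 < k < s)%N -> pt k%:R * top_coef b k + pb k%:R * bot_coef b k +
     pm k%:R * mid_coef b k = 0) ->
  rm = pt 0 * top_coef b 0 + pb 0 * bot_coef b 0 + pm 0 * mid_coef b 0 ->
  rp = pt s%:R * top_coef b s + pb s%:R * bot_coef b s + pm s%:R * mid_coef b s ->
  analytic_up_to_removable D (apparent_poles R n.+1 M) (observable b pt pb pm rm rp).
Proof.
move=> ptan pban pman Ds inner rmE rpE.
apply: (@removable_simple_poles R D s.+1 _
  (fun z => expect (fun=> 1) * pt z + expect (fun=> 1) * pb z)
  (fun (k : 'I_s.+1) z => top_coef b k * pt z + (bot_coef b k * pb z + (mid_coef b k * pm z
     + (if k == 0 :> nat then - rm else if k == s :> nat then - rp else 0))))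
  (fun k : 'I_s.+1 => (k : nat)%:R)).
- exact: analyticD (analyticZ _ ptan) (analyticZ _ pban).
- move=> k /=; set r := if _ then _ else _.
  have midan := analyticD (analyticZ (mid_coef b k) pman) (@analytic_cst R D r).
  have botan := analyticD (analyticZ (bot_coef b k) pban) midan.
  exact: (analyticD (analyticZ (top_coef b k) ptan) botan).
- by move=> k; apply: Ds; rewrite -ltnS.
- by move=> k; exists (k : nat) => //; rewrite -ltnS.
- move=> k /=; have [k0|k0] := eqVneq (k : nat) 0%N.
    by rewrite k0 rmE; ring.
  have [ks|ks] := eqVneq (k : nat) s.
    by rewrite ks rpE; ring.
  rewrite -[RHS](inner k); first by ring.
  by have := ltn_ord k; lia.
- move=> z zS; apply: observable_expansion => k ks; apply/eqP => zk; apply: zS.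
  by exists k.
Qed.

End Observables.

(** * Boundary terms, and the two observables *)

Section Boundary.

Context (R : realType) (p M : nat) (w tau : R -> R[i]).
Local Notation n := p.+1.
Local Notation N := p.+2.
Local Notation s := (M + p.+2)%N.
Local Notation X := (config N M).
Implicit Types (x : X) (phi_t phi_b phi_m : R[i] -> R[i]).
Local Notation A := (@top_coef R n M w tau).
Local Notation B := (@bot_coef R n M w tau).
Local Notation C := (@mid_coef R n M w tau).

Lemma expect_onE (P : pred X) (F : X -> R[i]) :
  @expect_on R N M w tau P F =
  \sum_(x in interlacing N M) (if P x then F x else 0) * @mass R N M w tau x.
Proof.
by rewrite /expect_on big_mkcondr /=; apply: eq_bigr => x _; case: ifP; rewrite ?mul0r.
Qed.

Lemma probE (P : pred X) :
  @prob R N M w tau P = \sum_(x in interlacing N M) (P x)%:R * @mass R N M w tau x.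
Proof.
rewrite /prob big_mkcondr /=; apply: eq_bigr => x _.
by case: (P x); rewrite ?mul1r ?mul0r.
Qed.

Lemma count_single (I : finType) (f : I -> nat) (k : nat) i :
  (forall j, f j = k -> j = i) -> \sum_(j | f j == k) 1 = (f i == k)%:R :> R[i].
Proof.
move=> fk; have [fik|fik] := eqVneq (f i) k.
  by rewrite (big_pred1 i) // => j /=; apply/eqP/eqP => [/fk|->].
by rewrite big_pred0// => j; apply: contraNF fik => /eqP /[dup] /fk -> ->.
Qed.

Lemma count_none (I : finType) (f : I -> nat) (k : nat) :
  (forall j, f j != k) -> \sum_(j | f j == k) 1 = 0 :> R[i].
Proof. by move=> fk; rewrite big_pred0// => j; exact: negbTE. Qed.

Section Extremal.
Context (x : X) (xI : x \in interlacing N M).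

Lemma ell_zero (i : 'I_N) : ell x i.+1 = 0%N -> i = ord_max.
Proof.
move=> h; have := ell_bound xI i; have := ltn_ord i => hi hb; apply: val_inj => /=; lia.
Qed.

Lemma ell_max (i : 'I_N) : (ell x i.+1).+1 = s -> i = ord0.
Proof.
move=> h; have := ell_bound xI i => hb; apply: val_inj => /=; lia.
Qed.

Lemma emm_one (i : 'I_n) : emm x i.+1 = 1%N -> i = ord_max.
Proof.
move=> h; apply: val_inj; apply/eqP; rewrite eqn_leq -ltnS ltn_ord /= leqNgt.
apply/negP => hi; have := @emm_decr _ _ _ xI i ord_max hi.
by have := emm_bounds xI ord_max; rewrite h; lia.
Qed.

Lemma emm_max (i : 'I_n) : (emm x i.+1).+1 = s -> i = ord0.
Proof.
move=> h; apply: val_inj; apply/eqP; rewrite /= -leqn0 leqNgt.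
apply/negP => hi; have := @emm_decr _ _ _ xI ord0 i hi.
by have := emm_bounds xI ord0; rewrite -h; lia.
Qed.

End Extremal.

(** Each of the four boundary constants is the residue at [0] or [s]: at these
    points only the lowest, respectively the highest, particle of a family can
    contribute, so the sums reduce to one extremal index. *)
Lemma r1_minusE phi_t phi_b phi_m : @r1_minus R N M w tau phi_t =
  phi_t 0 * A false 0 + phi_b 0 * B false 0 + phi_m 0 * C false 0.
Proof.
have -> : B false 0 = 0.
  by rewrite /bot_coef big1// => x xI; rewrite polar_coef_eq0 ?mul0r.
have -> : C false 0 = 0.
  rewrite /mid_coef big1// => x xI.
  rewrite (count_none (f := fun i : 'I_N => zero_top false (ell x i.+1))); last first.
    by move=> i; rewrite /zero_top addn1.
  rewrite (count_none (f := fun i : 'I_n => emm x i.+1)) ?subrr ?mulr0 ?mul0r// => i.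
  by have := emm_bounds xI i; lia.
rewrite !mulr0 !addr0 /r1_minus expect_onE mulNr -mulrN; congr (_ * _).
rewrite -sumrN; apply: eq_bigr => x xI; rewrite -mulNr; congr (_ * _).
rewrite (@polar_coef_single _ _ _ _ _ ord_max); last first.
  by move=> i /eqP; rewrite /pole_top addn0 => /eqP /(ell_zero xI).
rewrite /pole_top addn0; case: ifP => [/eqP h|_]; last by rewrite oppr0.
rewrite /zero_top addn1 h sub0r mulN1r; congr (- _).
rewrite prod_nat1_ord (prod_neq_last n
  (fun i => (0%:R - (ell x i.+1 + ~~ false)%:R) / (0%:R - (ell x i.+1 + false)%:R))).
by apply: eq_bigr => i _; rewrite addn0 addn1 !sub0r invrN mulrNN -natr1.
Qed.

Lemma r1_plusE phi_t phi_b phi_m : @r1_plus R N M w tau phi_b phi_m =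
  phi_t s%:R * A false s + phi_b s%:R * B false s + phi_m s%:R * C false s.
Proof.
have -> : A false s = 0.
  rewrite /top_coef big1// => x xI; rewrite polar_coef_eq0 ?mul0r// => i.
  by rewrite /pole_top addn0 ltn_eqF// ell_lt.
rewrite mulr0 add0r /r1_plus expect_onE probE; congr (_ * _ + _ * _).
  apply: eq_bigr => x xI; congr (_ * _).
  rewrite (@polar_coef_single _ _ _ _ _ ord0); last first.
    by move=> i; rewrite /pole_bot => /(emm_max xI).
  have -> : (pole_bot false (emm x (ord0 : 'I_n).+1) == s) = (emm x 1 == s.-1).
    by rewrite /pole_bot /=; move: (emm x 1) => v; lia.
  case: ifP => [/eqP h|_] //.
  have -> : s%:R - (emm x 1)%:R = 1 :> R[i].
    by rewrite (_ : s = s.-1.+1) ?h -?natr1; [ring|lia].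
  rewrite mul1r !big_add1 big_mkord (prod_neq_first p
    (fun i => (s%:R - (emm x i.+1)%:R) / (s%:R - (emm x i.+1).+1%:R))).
  by apply: eq_bigr => i _; rewrite -[X in _ = _ / (_ - X)]natr1 opprD addrA.
apply: eq_bigr => x xI; congr (_ * _).
rewrite expr0 mul1r (count_none (f := fun i : 'I_n => emm x i.+1)); last first.
  by move=> i; have := emm_bounds xI i; lia.
rewrite subr0 (@count_single _ (fun i : 'I_N => zero_top false (ell x i.+1)) _ ord0).
  by congr ((nat_of_bool _)%:R); rewrite /zero_top /=; move: (ell x 1) => v; lia.
by move=> i; rewrite /zero_top addn1 => /(ell_max xI).
Qed.

Lemma r2_minusE phi_t phi_b phi_m : @r2_minus R N M w tau phi_b phi_m =
  phi_t 0 * A true 0 + phi_b 0 * B true 0 + phi_m 0 * C true 0.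
Proof.
have -> : A true 0 = 0.
  by rewrite /top_coef big1// => x xI; rewrite polar_coef_eq0 ?mul0r// => i; rewrite /pole_top addn1.
rewrite mulr0 add0r /r2_minus expect_onE probE mulNr -!mulrN -!sumrN; congr (_ * _ + _ * _).
  apply: eq_bigr => x xI; rewrite -mulNr; congr (_ * _).
  rewrite (@polar_coef_single _ _ _ _ _ ord_max); last first.
    move=> i; have := emm_bounds xI i => hb h; apply: (emm_one xI).
    by move: h hb; rewrite /pole_bot; lia.
  have -> : (pole_bot true (emm x (ord_max : 'I_n).+1) == 0%N) = (emm x N.-1 == 1%N).
    by have := emm_bounds xI ord_max; rewrite /pole_bot /=; lia.
  case: ifP => [/eqP h|_]; last by rewrite oppr0.
  rewrite /= in h; rewrite /= h sub0r mulN1r; congr (- _).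
  rewrite prod_nat1_ord (prod_neq_last p
    (fun i => (0%:R - (emm x i.+1)%:R) / (0%:R - (pole_bot true (emm x i.+1))%:R))).
  apply: eq_bigr => i _; rewrite !sub0r invrN mulrNN /pole_bot.
  have := emm_bounds xI (widen_ord (leqnSn p) i) => /= /andP[+ _].
  by case: (emm x i.+1) => // v _; rewrite -natr1 addrK.
apply: eq_bigr => x xI; rewrite -mulNr; congr (_ * _).
rewrite expr1 (count_none (f := fun i : 'I_n => emm x i.+1)); last first.
  by move=> i; have := emm_bounds xI i; lia.
rewrite subr0 (@count_single _ (fun i : 'I_N => zero_top true (ell x i.+1)) _ ord_max).
  by rewrite /zero_top addn0 mulN1r.
by move=> i; rewrite /zero_top addn0 => /(ell_zero xI).
Qed.

Lemma r2_plusE phi_t phi_b phi_m : @r2_plus R N M w tau phi_t =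
  phi_t s%:R * A true s + phi_b s%:R * B true s + phi_m s%:R * C true s.
Proof.
have -> : B true s = 0.
  rewrite /bot_coef big1// => x xI; rewrite polar_coef_eq0 ?mul0r// => i.
  by have := emm_bounds xI i; rewrite /pole_bot; lia.
have -> : C true s = 0.
  rewrite /mid_coef big1// => x xI.
  rewrite (count_none (f := fun i : 'I_N => zero_top true (ell x i.+1))); last first.
    by move=> i; rewrite /zero_top addn0 ltn_eqF// ell_lt.
  rewrite (count_none (f := fun i : 'I_n => emm x i.+1)) ?subrr ?mulr0 ?mul0r// => i.
  by have := emm_bounds xI i; lia.
rewrite !mulr0 !addr0 /r2_plus expect_onE; congr (_ * _).
apply: eq_bigr => x xI; congr (_ * _).
rewrite (@polar_coef_single _ _ _ _ _ ord0); last first.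
  by move=> i; rewrite /pole_top addn1 => /(ell_max xI).
have -> : (pole_top true (ell x (ord0 : 'I_N).+1) == s) = (ell x 1 == s.-1).
  by rewrite /pole_top /=; move: (ell x 1) => v; lia.
rewrite /zero_top addn0.
case: ifP => [/eqP h|_] //.
have -> : s%:R - (ell x (ord0 : 'I_N).+1)%:R = 1 :> R[i].
  by rewrite (_ : s = s.-1.+1) ?h -?natr1; [ring|lia].
rewrite mul1r !big_add1 big_mkord (prod_neq_first n
  (fun i => (s%:R - (ell x i.+1 + ~~ true)%:R) / (s%:R - (ell x i.+1 + true)%:R))).
by apply: eq_bigr => i _; rewrite addn0 addn1 -[X in _ = _ / (_ - X)]natr1 opprD addrA.
Qed.

Lemma R1E phi_t phi_b phi_m : R1 N M w tau phi_t phi_b phi_m =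
  @observable R n M w tau false phi_t phi_b phi_m
    (@r1_minus R N M w tau phi_t) (@r1_plus R N M w tau phi_b phi_m).
Proof.
apply/funext => z; rewrite /R1 /observable.
congr (_ * _ + _ * _ + _ * _ - _ - _); apply: eq_bigr => x _; congr (_ * _).
- rewrite prod_nat1_ord; apply: eq_bigr => i _.
  by rewrite /zero_top /pole_top addn0 addn1 -natr1 opprD addrA.
- rewrite prod_nat1_ord; apply: eq_bigr => i _.
  by rewrite /pole_bot -[X in _ = _ / (_ - X)]natr1 opprD addrA.
- rewrite expr0 mul1r !sum_nat1_ord; congr (_ - _); apply: eq_bigr => i _.
  by rewrite /zero_top addn1 -natr1 opprD addrA.
Qed.

Lemma R2E phi_t phi_b phi_m : R2 N M w tau phi_t phi_b phi_m =
  @observable R n M w tau true phi_t phi_b phi_m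
    (@r2_minus R N M w tau phi_b phi_m) (@r2_plus R N M w tau phi_t).
Proof.
apply/funext => z; rewrite /R2 /observable.
congr (_ * _ + _ * _ + _ * _ - _ - _); apply: eq_bigr => x _; congr (_ * _).
- rewrite prod_nat1_ord; apply: eq_bigr => i _.
  by rewrite /zero_top /pole_top addn0 addn1 -[X in _ = _ / (_ - X)]natr1 opprD addrA.
- rewrite prod_nat1_ord; apply: eq_bigr => i _.
  have : (0 < emm x i.+1)%N by rewrite emmE; have := ltn_ord i; lia.
  rewrite /pole_bot; case: (emm x i.+1) => // v _ /=.
  by rewrite -natr1; congr (_ / _); ring.
- rewrite expr1 mulN1r opprB !sum_nat1_ord; congr (_ - _); apply: eq_bigr => i _.
  by rewrite /zero_top addn0.
Qed.

End Boundary.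

(** Since [x / 0 = 0], a nonzero quotient has a nonzero denominator. *)
Lemma num_of_quotient (F : fieldType) (x y q : F) : x / y = q -> q != 0 -> x = y * q.
Proof.
move=> <-; have [->|y0 _] := eqVneq y 0; first by rewrite invr0 mulr0 eqxx.
by rewrite mulrC divfK.
Qed.

Lemma interior_coef (R : realType) (n M : nat) (w tau : R -> R[i]) (b : bool) (k : nat)
    (phi_t phi_b phi_m : R[i]) (s := (M + n.+1)%N) :
  (0 < k < s)%N ->
  (forall v : nat, (v < s)%N -> w v%:R != 0) ->
  (forall v : nat, (0 < v < s)%N -> tau v%:R != 0) ->
  phi_t = phi_m * (if b then w k%:R / w k.-1%:R else w k.-1%:R / w k%:R) ->
  (if b then (k.+1 < s)%N -> phi_b = phi_m * (tau k%:R / tau k.+1%:R)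
   else (1 < k)%N -> phi_b = phi_m * (tau k%:R / tau k.-1%:R)) ->
  phi_t * @top_coef R n M w tau b k + phi_b * @bot_coef R n M w tau b k +
  phi_m * @mid_coef R n M w tau b k = 0.
Proof.
move=> k0s w0 tau0 tE bE; rewrite top_coefE bot_coefE mid_coefE !mulrA -!mulrDl.
by rewrite (@interior_residue _ n s (fun v => w v%:R) (fun v => tau v%:R) b k _ _ _ k0s w0 tau0 tE bE) mul0r.
Qed.

Theorem theorem2p3 (R : realType) (N M : nat) (hN : (2 <= N)%N) (hM : (1 <= M)%N)
  (w tau : R -> R[i])
  (w_neq0 : forall x : R, 0 <= x <= (M + N)%:R - 1 -> w x != 0)
  (tau_neq0 : forall x : R, 1 <= x <= (M + N)%:R - 1 -> tau x != 0)
  (Z_neq0 : partition_function N M w tau != 0)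
  (D : set (R[i])^o) (D_open : open D)
  (D_segment : forall x : R, 0 <= x <= (M + N)%:R -> D (x%:C))
  (phi1t phi1b phi1m phi2t phi2b phi2m : R[i] -> R[i])
  (phi1t_an : analytic_on D phi1t) (phi1b_an : analytic_on D phi1b)
  (phi1m_an : analytic_on D phi1m)
  (phi2t_an : analytic_on D phi2t) (phi2b_an : analytic_on D phi2b)
  (phi2m_an : analytic_on D phi2m)
  (phi1_tm : forall x : R, 1 <= x <= (M + N)%:R - 1 ->
     phi1t x%:C / phi1m x%:C = w (x - 1) / w x)
  (phi1_bm : forall x : R, 2 <= x <= (M + N)%:R - 1 ->
     phi1b x%:C / phi1m x%:C = tau x / tau (x - 1))
  (phi2_tm : forall x : R, 1 <= x <= (M + N)%:R - 1 ->
     phi2t x%:C / phi2m x%:C = w x / w (x - 1))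
  (phi2_bm : forall x : R, 2 <= x <= (M + N)%:R - 1 ->
     phi2b (x - 1)%:C / phi2m (x - 1)%:C = tau (x - 1) / tau x) :
  analytic_up_to_removable D (apparent_poles R N M)
    (R1 N M w tau phi1t phi1b phi1m) /\
  analytic_up_to_removable D (apparent_poles R N M)
    (R2 N M w tau phi2t phi2b phi2m).
Proof.
case: N hN w_neq0 tau_neq0 Z_neq0 D_segment phi1_tm phi1_bm phi2_tm phi2_bm => [|[|p]] // _.
set s := (M + p.+2)%N => w_neq0 tau_neq0 _ D_segment phi1_tm phi1_bm phi2_tm phi2_bm.
have natC (k : nat) : (k%:R)%:C = k%:R :> R[i] by rewrite rmorph_nat.
have inseg (a v : nat) : (a <= v < s)%N -> a%:R <= (v%:R : R) <= s%:R - 1.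
  by move=> /andP[av vs]; rewrite lerBrDr natr1 !ler_nat av vs.
have inseg1 (v : nat) : (0 < v < s)%N -> 1 <= (v%:R : R) <= s%:R - 1.
  by move=> /(inseg 1%N); rewrite mulr1n.
have subn1R (v : nat) : (0 < v)%N -> v%:R - 1 = v.-1%:R :> R.
  by case: v => // v _; rewrite -natr1 addrK.
have w0 (v : nat) : (v < s)%N -> w v%:R != 0.
  by move=> vs; apply: w_neq0; rewrite ler0n lerBrDr natr1 ler_nat.
have tau0 (v : nat) : (0 < v < s)%N -> tau v%:R != 0.
  by move=> vs; apply: tau_neq0; exact: inseg1.
have Ds (k : nat) : (k <= s)%N -> D k%:R.
  by move=> ks; rewrite -natC; apply: D_segment; rewrite ler0n ler_nat.
have quot0 (x y : R[i]) : x != 0 -> y != 0 -> x / y != 0.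
  by move=> x0 y0; rewrite mulf_neq0 ?invr_eq0.
rewrite R1E R2E; split; apply: observable_removable => //.
- move=> k k0s; apply: interior_coef => //.
    apply: num_of_quotient; last by apply: quot0; apply: w0; lia.
    have k0 : (0 < k)%N by lia.
    by rewrite -natC -(subn1R k k0) phi1_tm//; exact: inseg1.
  move=> k1; apply: num_of_quotient; last by apply: quot0; apply: tau0; lia.
  by rewrite -natC -(subn1R k (ltnW k1)) phi1_bm//; apply: (inseg 2%N k); lia.
- exact: r1_minusE.
- exact: r1_plusE.
- move=> k k0s; apply: interior_coef => //.
    apply: num_of_quotient; last by apply: quot0; apply: w0; lia.
    have k0 : (0 < k)%N by lia.
    by rewrite -natC -(subn1R k k0) phi2_tm//; exact: inseg1.
  move=> ks; apply: num_of_quotient; last by apply: quot0; apply: tau0; lia.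
  (* The relation for [phi2b] at [k] is the hypothesis at [k + 1]. *)
  have := phi2_bm k.+1%:R; rewrite (subn1R k.+1)// natC; apply; apply: (inseg 2%N k.+1); lia.
- exact: r2_minusE.
- exact: r2_plusE.
Qed.
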